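(* \textsc{Isometric Path Partition} admits an algorithm running in time $n^{O(\mathsf{tw})}$, where $\mathsf{tw}$ is the treewidth of the input graph $G$ and $n$ denotes its number of vertices.
   Context: All graphs are finite, simple and undirected. A path in a graph $G$ is isometric if it is a shortest path in $G$ between its two endpoints. In the problem \textsc{Isometric Path Partition}, the input is a graph $G$ and an integer $k$, and the question is whether the vertex set of $G$ can be partitioned into $k$ sets, each of which induces (the vertex set of) an isometric path of $G$. *)

(* Defs.v *)
From mathcomp Require Import all_boot.
From mathcomp Require Import boolp.

Set Implicit Arguments.
Unset Strict Implicit.
Unset Printing Implicit Defensive.

Record sgraph (V : finType) := SGraph {
  adj :> rel V;
  adj_sym : symmetric adj;
  adj_irrefl : irreflexive adj }.

Section IsometricPaths.
Context {V : finType}.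
Variable G : sgraph V.

(* The path with vertex sequence x :: p, of length size p. *)
Definition is_path (x : V) (p : seq V) : Prop := path G x p /\ uniq (x :: p).

Definition isometric_path (x : V) (p : seq V) : Prop :=
  is_path x p /\
  forall q, is_path x q -> last x q = last x p -> size p <= size q.

Definition isometric_path_partition (k : nat) : Prop :=
  exists P : {set {set V}},
    [/\ partition P [set: V], #|P| = k &
        forall S, S \in P ->
          exists x p, isometric_path x p /\ S = [set v in x :: p]].

End IsometricPaths.

(* A repetition-free cyclic sequence of two vertices runs back and forth along
   an edge; a cycle of the graph is one with at least three vertices. *)
Definition is_tree (T : finType) (F : sgraph T) : Prop :=
  [/\ 0 < #|T|, forall s t : T, connect F s t &
      forall c : seq T, ucycle F c -> size c <= 2].

Section Treewidth.
Context {V : finType}.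
Variable G : sgraph V.

Definition tree_decomposition (T : finType) (F : sgraph T)
    (bag : T -> {set V}) : Prop :=
  [/\ is_tree F,
      forall v, exists t, v \in bag t,
      forall u v, G u v -> exists t, (u \in bag t) && (v \in bag t) &
      forall v s t, v \in bag s -> v \in bag t ->
        connect [rel i j | [&& F i j, v \in bag i & v \in bag j]] s t].

Definition width (T : finType) (bag : T -> {set V}) : nat :=
  (\max_(t : T) #|bag t|).-1.

Definition has_width (w : nat) : Prop :=
  exists (T : finType) (F : sgraph T) (bag : T -> {set V}),
    tree_decomposition F bag /\ width bag = w.

Lemma ex_has_width : exists w, `[< has_width w >].
Proof.
pose e := [rel _ _ : unit | false].
pose F : sgraph unit := @SGraph unit e (fun _ _ => erefl) (fun _ => erefl).
exists (width (fun _ : unit => [set: V])); apply/asboolP.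
exists unit, F, (fun _ => [set: V]); split=> //; split.
- split; first by rewrite card_unit.
  + by move=> [] []; apply: connect0.
  + by case=> [|x [|y c]] //=; rewrite /ucycle /ucycleb /= ?andbF.
- by move=> v; exists tt; rewrite inE.
- by move=> u v _; exists tt; rewrite !inE.
- by move=> v [] [] _ _; apply: connect0.
Qed.

(* The graph without vertices gets treewidth 0 (and not -1). *)
Definition treewidth : nat := ex_minn ex_has_width.

End Treewidth.

(* Random access machine with structured control flow.  It has a read-only
   input, a work memory that is initially 0 everywhere, and indirect addressing
   in both; cells hold natural numbers.  Every node of an expression and every
   command executed costs one unit.  There is no multiplication: the numbers
   arising within t steps have O(t) more bits than those in the input and the
   program, so that this unit cost is polynomially related to Turing machine
   time. *)
Inductive expr :=
| EConst of nat
| EInput of expr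
| ELoad of expr
| EAdd of expr & expr
| ESub of expr & expr.

Inductive cmd :=
| CSkip
| CStore of expr & expr
| CSeq of cmd & cmd
| CIf of expr & cmd & cmd
| CWhile of expr & cmd.

Definition memory := nat -> nat.

Definition memory0 : memory := fun=> 0.

Definition update (m : memory) (a v : nat) : memory :=
  fun b => if b == a then v else m b.

Fixpoint eval (inp : seq nat) (m : memory) (e : expr) : nat :=
  match e with
  | EConst c => c
  | EInput a => nth 0 inp (eval inp m a)
  | ELoad a => m (eval inp m a)
  | EAdd e1 e2 => eval inp m e1 + eval inp m e2
  | ESub e1 e2 => eval inp m e1 - eval inp m e2
  end.

Fixpoint cost (e : expr) : nat :=
  match e with
  | EConst _ => 1
  | EInput a | ELoad a => (cost a).+1
  | EAdd e1 e2 | ESub e1 e2 => (cost e1 + cost e2).+1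
  end.

(* exec inp c m t m' : on input inp, command c started in memory m halts after
   t units of time in memory m'. *)
Inductive exec (inp : seq nat) : cmd -> memory -> nat -> memory -> Prop :=
| exec_Skip m : exec inp CSkip m 1 m
| exec_Store a e m :
    exec inp (CStore a e) m (cost a + cost e).+1
      (update m (eval inp m a) (eval inp m e))
| exec_Seq c1 c2 m t1 m1 t2 m2 :
    exec inp c1 m t1 m1 -> exec inp c2 m1 t2 m2 ->
    exec inp (CSeq c1 c2) m (t1 + t2).+1 m2
| exec_IfT e c1 c2 m t m' :
    eval inp m e != 0 -> exec inp c1 m t m' ->
    exec inp (CIf e c1 c2) m (cost e + t).+1 m'
| exec_IfF e c1 c2 m t m' :
    eval inp m e = 0 -> exec inp c2 m t m' ->
    exec inp (CIf e c1 c2) m (cost e + t).+1 m'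
| exec_WhileT e c m t1 m1 t2 m2 :
    eval inp m e != 0 -> exec inp c m t1 m1 ->
    exec inp (CWhile e c) m1 t2 m2 ->
    exec inp (CWhile e c) m (cost e + t1 + t2).+1 m2
| exec_WhileF e c m :
    eval inp m e = 0 -> exec inp (CWhile e c) m (cost e).+1 m.

Lemma exec_det inp c m t1 m1 t2 m2 :
  exec inp c m t1 m1 -> exec inp c m t2 m2 -> t1 = t2 /\ m1 = m2.
Proof.
move=> E; elim: E t2 m2 => {c m t1 m1} => [m|a e m|c1 c2 m t1 m1 t2 m2 _ IH1
  _ IH2|e c1 c2 m t m' He _ IH|e c1 c2 m t m' He _ IH|e c m t1 m1 t2 m2 He _ IH1
  _ IH2|e c m He] t3 m3 E; inversion E as
    [|? ? ?|? ? ? ? ? ? ? E1 E2|? ? ? ? ? ? He' E1|? ? ? ? ? ? He' E1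
    |? ? ? ? ? ? ? He' E1 E2|? ? ? He']; subst => //;
  try by [rewrite He in He' | rewrite He' in He].
- by have [? ?] := IH1 _ _ E1; subst; have [-> ->] := IH2 _ _ E2.
- by have [-> ->] := IH _ _ E1.
- by have [-> ->] := IH _ _ E1.
- by have [? ?] := IH1 _ _ E1; subst; have [-> ->] := IH2 _ _ E2.
Qed.

(* l lists every edge of G exactly once, in one of its two orientations. *)
Definition edge_list n (G : sgraph 'I_n) (l : seq ('I_n * 'I_n)) : Prop :=
  forall u v, count_mem (u, v) l + count_mem (v, u) l = G u v.

Definition encode n (l : seq ('I_n * 'I_n)) (k : nat) : seq nat :=
  [:: n, k, size l & flatten [seq [:: val uv.1; val uv.2] | uv <- l]].

(* Main.v *)
Require Import Defs.
From mathcomp Require Import all_boot zify.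
From mathcomp Require Import boolp.

Set Implicit Arguments.
Unset Strict Implicit.
Unset Printing Implicit Defensive.

(** A partition into isometric paths is the same as a labelling of every vertex v
    by the start x of its path and the neighbours p and s of v on it, subject to
    conditions on single vertices and on edges: the distance from x increases by
    one from p to v, and p and s agree with v about the path. The number of paths
    is the number of vertices with p = v. This is a binary constraint problem with
    O(n^3) labels, solved by dynamic programming over bags of m + 1 labelled
    vertices: given a bag, the components of the rest that touch its head are
    treated one by one in the order of their least vertices, and for such a
    component a new bag is guessed, whose head lies in the component and whose
    tail, taken from the old bag, contains the neighbourhood of the component.
    For fixed m the table has n^O(m) cells.

    No tree decomposition is computed. If the trivial partition into n single
    vertices is derivable for m, then relabelling its derivation shows that every
    partition is; so the least m for which this happens decides the instance. A
    tree decomposition of width w shows m <= w: weigh a vertex by the size of the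
    subtree below the topmost node containing it. If the neighbours of a connected
    set D weigh at least as much as all of D, then they share a bag with some
    vertex of D, hence there are at most w of them; and this condition persists
    when the heaviest vertex of D is chosen as the new head. *)

(** * Polynomial-time computation with registers and a heap *)

Definition poly_bound (K B : nat) := K * B.+1 ^ K.

Lemma leq_poly_bound K K' B B' :
  K <= K' -> B <= B' -> poly_bound K B <= poly_bound K' B'.
Proof.
move=> leK leB; apply: leq_mul => //.
apply: (@leq_trans (B.+1 ^ K')); first exact: leq_pexp2l.
by case: K' {leK} => // K'; rewrite leq_exp2r.
Qed.

Lemma leq_const_poly_bound K B : K <= poly_bound K B.
Proof. by rewrite leq_pmulr // expn_gt0. Qed.

Lemma leq_poly_boundD K1 K2 B x y :
  x <= poly_bound K1 B -> y <= poly_bound K2 B -> x + y <= poly_bound (K1 + K2) B.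
Proof.
move=> le_x le_y; apply: leq_trans (leq_add le_x le_y) _; rewrite /poly_bound mulnDl.
by apply: leq_add; rewrite leq_mul2l (leq_pexp2l (ltn0Sn B)) ?leq_addl ?leq_addr ?orbT.
Qed.

Lemma leq_poly_boundM K B b x :
  b <= B -> x <= poly_bound K B -> b * x <= poly_bound K.+1 B.
Proof.
move=> le_b le_x; apply: leq_trans (leq_mul (leqW le_b) le_x) _.
by rewrite /poly_bound expnS mulnCA leq_mul2r leqnSn orbT.
Qed.

(* The exponent K depends on the program only, the size B on the input. *)
Definition runs inp B K c m (Q : memory -> Prop) : Prop :=
  exists t m', [/\ exec inp c m t m', t <= poly_bound K B & Q m'].

Definition reg (r : nat) := ELoad (EConst r.*2).
Definition heap_addr (e : expr) := EAdd (EConst 1) (EAdd e e).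
Definition set_reg (r : nat) (e : expr) := CStore (EConst r.*2) e.
Definition incr_reg (r : nat) := set_reg r (EAdd (reg r) (EConst 1)).
Definition set_heap (a e : expr) := CStore (heap_addr a) e.

Definition for_loop (counter limit : nat) (body : cmd) :=
  CSeq (set_reg counter (EConst 0))
    (CWhile (ESub (reg limit) (reg counter)) (CSeq body (incr_reg counter))).

Lemma update_same m a v : update m a v a = v.
Proof. by rewrite /update eqxx. Qed.

Lemma update_neq m a b v : b != a -> update m a v b = m b.
Proof. by rewrite /update => /negPf->. Qed.

Lemma update_reg m r s v : s != r -> update m r.*2 v s.*2 = m s.*2.
Proof. by move=> sr; rewrite update_neq // (inj_eq double_inj). Qed.

Lemma double_neq_doubleS a b : a.*2 != b.*2.+1.
Proof. by apply/negP => /eqP/(congr1 odd); rewrite /= !odd_double. Qed.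

Lemma update_reg_heap m r a v : update m r.*2 v a.*2.+1 = m a.*2.+1.
Proof. by rewrite update_neq // eq_sym double_neq_doubleS. Qed.

Lemma update_heap_reg m r a v : update m a.*2.+1 v r.*2 = m r.*2.
Proof. by rewrite update_neq // double_neq_doubleS. Qed.

Section Runs.
Variables (inp : seq nat) (B : nat).
Implicit Types (m : memory) (e : expr) (P Q : memory -> Prop).

Lemma runsW B' K K' c m P Q : B' <= B -> K' <= K -> (forall m', P m' -> Q m') ->
  runs inp B' K' c m P -> runs inp B K c m Q.
Proof.
move=> leB leK PQ [t [m' [E le_t Pm']]]; exists t, m'; split=> //; last exact: PQ.
exact: leq_trans le_t (leq_poly_bound leK leB).
Qed.

Lemma runs_seq K1 K2 c1 c2 m P Q : runs inp B K1 c1 m P ->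
  (forall m', P m' -> runs inp B K2 c2 m' Q) ->
  runs inp B (K1 + K2 + 1) (CSeq c1 c2) m Q.
Proof.
move=> [t1 [m1 [E1 le_t1 Pm1]]] /(_ m1 Pm1)[t2 [m2 [E2 le_t2 Qm2]]].
exists (t1 + t2).+1, m2; split=> //; first exact: exec_Seq E1 E2.
rewrite -addn1; apply: leq_poly_boundD (leq_const_poly_bound 1 B).
exact: leq_poly_boundD.
Qed.

Lemma runs_store a e m Q : Q (update m (eval inp m a) (eval inp m e)) ->
  runs inp B (cost a + cost e).+1 (CStore a e) m Q.
Proof.
move=> Qm; do 2!eexists; split; [exact: exec_Store | exact: leq_const_poly_bound |].
exact: Qm.
Qed.

Lemma runs_set_reg r e m Q : Q (update m r.*2 (eval inp m e)) ->
  runs inp B (cost e).+2 (set_reg r e) m Q.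
Proof. exact: (@runs_store (EConst r.*2)). Qed.

Lemma runs_incr_reg r m Q : Q (update m r.*2 (m r.*2).+1) ->
  runs inp B 6 (incr_reg r) m Q.
Proof. by move=> Qm; apply: runs_set_reg; rewrite /= addn1. Qed.

Lemma runs_set_heap a e m Q : Q (update m (eval inp m a).*2.+1 (eval inp m e)) ->
  runs inp B (cost (heap_addr a) + cost e).+1 (set_heap a e) m Q.
Proof. by move=> Qm; apply: runs_store; rewrite /= add1n addnn. Qed.

Lemma runs_if K1 K2 e c1 c2 m Q :
  (eval inp m e != 0 -> runs inp B K1 c1 m Q) ->
  (eval inp m e = 0 -> runs inp B K2 c2 m Q) ->
  runs inp B (K1 + K2 + (cost e).+1) (CIf e c1 c2) m Q.
Proof.
move=> run1 run2; have le_time t : t <= poly_bound (K1 + K2) B ->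
    (cost e + t).+1 <= poly_bound (K1 + K2 + (cost e).+1) B.
  by move=> le_t; rewrite -addSn addnC leq_poly_boundD ?leq_const_poly_bound.
case: (eqVneq (eval inp m e) 0) => [e0|e1].
  have [t [m' [E le_t Qm']]] := run2 e0; exists (cost e + t).+1, m'; split=> //.
    exact: exec_IfF.
  exact/le_time/(leq_trans le_t)/leq_poly_bound/leqnn/leq_addl.
have [t [m' [E le_t Qm']]] := run1 e1; exists (cost e + t).+1, m'; split=> //.
  exact: exec_IfT.
exact/le_time/(leq_trans le_t)/leq_poly_bound/leqnn/leq_addr.
Qed.

Lemma runs_while K N e c m (I : nat -> memory -> Prop) : N <= B ->
  (forall i m, i < N -> I i m -> eval inp m e != 0 /\ runs inp B K c m (I i.+1)) ->
  (forall m, I N m -> eval inp m e = 0) -> I 0 m ->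
  runs inp B ((K + (cost e).+1).+1 + (cost e).+1) (CWhile e c) m (I N).
Proof.
move=> leNB step stop I0.
suff loop j i m1 : i + j = N -> I i m1 -> exists t m', [/\ exec inp (CWhile e c) m1 t m',
    t <= j * (poly_bound K B + (cost e).+1) + (cost e).+1 & I N m'].
  have [t [m' [E le_t IN]]] := loop N 0 m (add0n N) I0; exists t, m'; split=> //.
  apply: leq_trans le_t (leq_poly_boundD _ (leq_const_poly_bound _ B)).
  by apply: leq_poly_boundM leNB _; apply: leq_poly_boundD (leq_const_poly_bound _ B).
elim: j i m1 => [|j IH] i m1 ijN Im1.
  rewrite addn0 in ijN; rewrite ijN in Im1; exists (cost e).+1, m1; split=> //.
  exact/exec_WhileF/stop.
have [|e1 [t1 [m2 [E1 le_t1 Im2]]]] := step i m1 _ Im1; first by lia.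
have [|t2 [m3 [E2 le_t2 Im3]]] := IH i.+1 m2 _ Im2; first by lia.
exists (cost e + t1 + t2).+1, m3; split=> //; first exact: exec_WhileT E1 E2.
by rewrite mulSn; lia.
Qed.

Lemma runs_for K N counter limit body m (I : nat -> memory -> Prop) :
  limit != counter -> N <= B -> m limit.*2 = N ->
  (forall i m' v, I i m' -> I i (update m' counter.*2 v)) ->
  (forall i m', i < N -> I i m' -> m' counter.*2 = i ->
     runs inp B K body m' (fun m'' =>
       [/\ I i.+1 m'', m'' limit.*2 = m' limit.*2 & m'' counter.*2 = i])) ->
  I 0 m -> runs inp B (K + 24) (for_loop counter limit body) m (I N).
Proof.
move=> neq leNB limit_m I_update step I0.
pose inv i m' := [/\ I i m', m' limit.*2 = N & m' counter.*2 = i].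
have -> : K + 24 = 3 + ((K + 6 + 1 + 6).+1 + 6) + 1 by lia.
apply: (runs_seq (P := inv 0)) => [|m0 inv0].
  by apply: runs_set_reg; split; rewrite ?update_same ?update_reg //; apply: I_update.
apply: (runsW (P := inv N) (leqnn _) (leqnn _)) => [m' []//|].
apply: (runs_while leNB) inv0 => [i m1 iN [Ii limit1 counter1]|m1 [_ limit1 counter1]];
  last by rewrite /= limit1 counter1 subnn.
split; first by rewrite /= limit1 counter1 subn_eq0 -ltnNge.
apply: runs_seq (step i m1 iN Ii counter1) _ => m2 [IiS limit2 counter2].
apply: runs_incr_reg; rewrite counter2; split; first exact: I_update.
  by rewrite update_reg // limit2.
by rewrite update_same.
Qed.

End Runs.

(** * Closure properties of computable functions *)

(* The elements of a context are the situations in which a program may be run. *)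
Record ctx := Ctx {
  csort :> Type;
  cinp : csort -> seq nat;
  cheap : csort -> nat -> nat;
  cbound : csort -> nat;
  cvars : seq (csort -> nat) }.

(* Registers live at even addresses, the heap at odd ones; ls tells which
   register holds each variable of the context. *)
Definition stores (X : ctx) (ls : seq nat) (x : X) (m : memory) : Prop :=
  (forall j, j < size ls ->
     m (nth 0 ls j).*2 = nth (fun=> 0) (cvars X) j x) /\
  (forall a, m a.*2.+1 = cheap x a).

Definition agree (s : nat) (m m' : memory) : Prop :=
  (forall r, r < s -> m' r.*2 = m r.*2) /\ forall a, m' a.*2.+1 = m a.*2.+1.

Definition in_registers (X : ctx) (ls : seq nat) (s : nat) : bool :=
  (size ls == size (cvars X)) && all (fun r => r < s) ls.

Variant computable (X : ctx) (f : X -> nat) : Prop := Computable of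
  forall ls s, in_registers X ls s ->
  exists (c : cmd) (K : nat), forall (x : X) m, stores ls x m ->
  runs (cinp x) (cbound x) K c m (fun m' => m' s.*2 = f x /\ agree s m m').

Definition bounded (X : ctx) (f : X -> nat) : Prop := forall x, f x <= cbound x.

Record small (X : ctx) (f : X -> nat) : Prop := Small {
  small_computable :> computable f;
  small_bounded : bounded f }.

Lemma agree_trans s m1 m2 m3 : agree s m1 m2 -> agree s m2 m3 -> agree s m1 m3.
Proof.
move=> [reg12 heap12] [reg23 heap23].
by split=> [r rs|a]; rewrite ?reg23 ?reg12 ?heap23 ?heap12.
Qed.

Lemma agreeW s s' m m' : s <= s' -> agree s' m m' -> agree s m m'.
Proof.
by move=> le_s [regs heap]; split=> // r rs; apply/regs/(leq_trans rs).
Qed.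

Lemma agree_update s r m v : s <= r -> agree s m (update m r.*2 v).
Proof.
move=> sr; split=> [r' r's|a]; last exact: update_reg_heap.
by rewrite update_reg // ltn_eqF // (leq_trans r's).
Qed.

Lemma in_registersW (X : ctx) ls s s' :
  s <= s' -> in_registers X ls s -> in_registers X ls s'.
Proof.
move=> le_s /andP[size_ls ls_lt]; apply/andP; split=> //.
by apply: sub_all ls_lt => r /leq_trans; apply.
Qed.

Lemma stores_agree (X : ctx) ls s (x : X) m m' : in_registers X ls s ->
  agree s m m' -> stores ls x m -> stores ls x m'.
Proof.
move=> /andP[_ /allP ls_lt] [regs heap] [vars_m heap_m].
by split=> [j j_lt|a]; [rewrite regs ?vars_m // ls_lt ?mem_nth | rewrite heap].
Qed.

Section Closure.
Variable X : ctx.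
Implicit Types f g : X -> nat.

Lemma computable_ext f g : f =1 g -> computable f -> computable g.
Proof. by move=> /funext->. Qed.

Lemma computable_const v : computable (fun _ : X => v).
Proof.
split=> ls s _; exists (set_reg s (EConst v)); eexists=> x m _.
by apply: runs_set_reg; rewrite update_same; split=> //; apply: agree_update.
Qed.

Lemma computable_var j : j < size (cvars X) ->
  computable (nth (fun=> 0) (cvars X) j).
Proof.
move=> j_lt; split=> ls s /andP[/eqP size_ls _].
exists (set_reg s (reg (nth 0 ls j))); eexists=> x m [vars_m _].
apply: runs_set_reg; rewrite update_same /= vars_m ?size_ls //.
by split=> //; apply: agree_update.
Qed.

Lemma computable_unary (op : expr -> expr) (phi : X -> nat -> nat) f :
  (forall x e m, (forall a, m a.*2.+1 = cheap x a) ->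
     eval (cinp x) m (op e) = phi x (eval (cinp x) m e)) ->
  computable f -> computable (fun x => phi x (f x)).
Proof.
move=> eval_op [comp_f]; split=> ls s ls_s; have [c [K run_c]] := comp_f ls s ls_s.
exists (CSeq c (set_reg s (op (reg s)))); eexists=> x m sto.
apply: runs_seq (run_c x m sto) _ => m' [fx mm']; apply: runs_set_reg.
have [_ heap_m'] := stores_agree ls_s mm' sto.
rewrite update_same eval_op //= fx; split=> //.
exact: agree_trans mm' (agree_update _ _ _).
Qed.

Lemma computable_binary (op : expr -> expr -> expr) (phi : nat -> nat -> nat) f g :
  (forall inp m e e', eval inp m (op e e') = phi (eval inp m e) (eval inp m e')) ->
  computable f -> computable g -> computable (fun x => phi (f x) (g x)).
Proof.
move=> eval_op [comp_f] [comp_g]; split=> ls s ls_s.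
have [cf [Kf run_f]] := comp_f ls s ls_s.
have [cg [Kg run_g]] := comp_g ls s.+1 (in_registersW (leqnSn s) ls_s).
exists (CSeq cf (CSeq cg (set_reg s (op (reg s) (reg s.+1))))); eexists=> x m sto.
apply: runs_seq (run_f x m sto) _ => m1 [fx mm1].
apply: runs_seq (run_g x m1 (stores_agree ls_s mm1 sto)) _ => m2 [gx m1m2].
apply: runs_set_reg; rewrite update_same eval_op /= gx; split.
  by case: m1m2 => ->; rewrite ?fx.
apply: agree_trans mm1 (agree_trans (agreeW (leqnSn s) m1m2) _).
exact: agree_update.
Qed.

Lemma computable_input f : computable f ->
  computable (fun x => nth 0 (cinp x) (f x)).
Proof. exact: (@computable_unary EInput (fun x => nth 0 (cinp x))). Qed.

Lemma computable_heap f : computable f -> computable (fun x => cheap x (f x)).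
Proof.
apply: (@computable_unary (fun e => ELoad (heap_addr e)) (fun x => cheap x)).
by move=> x e m heap_m /=; rewrite add1n addnn heap_m.
Qed.

Lemma computable_add f g : computable f -> computable g ->
  computable (fun x => f x + g x).
Proof. exact: (@computable_binary EAdd addn). Qed.

Lemma computable_sub f g : computable f -> computable g ->
  computable (fun x => f x - g x).
Proof. exact: (@computable_binary ESub subn). Qed.

Lemma computable_succ f : computable f -> computable (fun x => (f x).+1).
Proof.
move=> comp_f; apply: computable_ext (computable_add comp_f (computable_const 1)).
by move=> x; rewrite addn1.
Qed.

Lemma computable_pred f : computable f -> computable (fun x => (f x).-1).
Proof.
move=> comp_f; apply: computable_ext (computable_sub comp_f (computable_const 1)).
by move=> x; rewrite subn1.
Qed.

Lemma computable_if (b : X -> bool) f g :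
  computable (fun x => b x) -> computable f -> computable g ->
  computable (fun x => if b x then f x else g x).
Proof.
move=> [comp_b] [comp_f] [comp_g]; split=> ls s ls_s.
have [cb [Kb run_b]] := comp_b ls s ls_s.
have [cf [Kf run_f]] := comp_f ls s ls_s.
have [cg [Kg run_g]] := comp_g ls s ls_s.
exists (CSeq cb (CIf (reg s) cf cg)); eexists=> x m sto.
apply: runs_seq (run_b x m sto) _ => m1 [bx mm1].
have sto1 := stores_agree ls_s mm1 sto.
apply: runs_if => /=; rewrite bx.
  rewrite eqb0 negbK => ->; apply: runsW (run_f x m1 sto1) => // m2 [fx m1m2].
  by split=> //; apply: agree_trans m1m2.
move/eqP; rewrite eqb0 => /negPf->.
apply: runsW (run_g x m1 sto1) => // m2 [gx m1m2].
by split=> //; apply: agree_trans m1m2.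
Qed.

Section Booleans.
Variables p q : X -> bool.
Hypotheses (comp_p : computable (fun x => p x)) (comp_q : computable (fun x => q x)).

Lemma computable_negb : computable (fun x => ~~ p x).
Proof.
apply: computable_ext (computable_sub (computable_const 1) comp_p) => x.
by case: (p x).
Qed.

Lemma computable_andb : computable (fun x => p x && q x).
Proof.
apply: computable_ext (computable_if comp_p comp_q (computable_const 0)) => x.
by case: (p x).
Qed.

Lemma computable_orb : computable (fun x => p x || q x).
Proof.
apply: computable_ext (computable_if comp_p (computable_const 1) comp_q) => x.
by case: (p x).
Qed.

Lemma computable_implyb : computable (fun x => p x ==> q x).
Proof.
apply: computable_ext (computable_if comp_p comp_q (computable_const 1)) => x.
by case: (p x).
Qed.

End Booleans.

Lemma computable_ifb (b p q : X -> bool) : computable (fun x => b x) ->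
  computable (fun x => p x) -> computable (fun x => q x) ->
  computable (fun x => if b x then p x else q x).
Proof.
move=> comp_b comp_p comp_q.
by apply: computable_ext (computable_if comp_b comp_p comp_q) => x; case: (b x).
Qed.

Lemma computable_leq f g : computable f -> computable g ->
  computable (fun x => f x <= g x).
Proof.
move=> comp_f comp_g; have comp_fg := computable_sub comp_f comp_g.
apply: computable_ext (computable_sub (computable_const 1) comp_fg) => x.
by case: leqP => /=; lia.
Qed.

Lemma computable_eq f g : computable f -> computable g ->
  computable (fun x => f x == g x).
Proof.
move=> comp_f comp_g.
have := computable_andb (computable_leq comp_f comp_g) (computable_leq comp_g comp_f).
by apply: computable_ext => x; rewrite eqn_leq.
Qed.

End Closure.

Arguments computable_const : clear implicits.

Section Iteration.
Variables (X : ctx) (b : X -> nat).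

Definition ext_sort := {x : X & ('I_(b x) * nat)%type}.
Definition ext_idx (y : ext_sort) : 'I_(b (tag y)) := (tagged y).1.
Definition ext_acc (y : ext_sort) : nat := (tagged y).2.

Definition ext : ctx :=
  @Ctx ext_sort (fun y => cinp (tag y)) (fun y => cheap (tag y))
    (fun y => cbound (tag y))
    [:: ext_acc, (fun y => nat_of_ord (ext_idx y))
      & [seq (fun y : ext_sort => f (tag y)) | f <- cvars X]].

Lemma computable_weaken (f : X -> nat) :
  computable f -> @computable ext (fun y => f (tag y)).
Proof.
move=> [comp_f]; split=> -[//|r1 [//|r2 ls]] s.
rewrite /in_registers /= size_map !eqSS => /and4P[size_ls _ _ ls_lt].
have [|c [K run_c]] := comp_f ls s; first by rewrite /in_registers size_ls.
exists c, K => y m [vars_m heap_m]; apply: run_c; split=> // j j_lt.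
by rewrite (vars_m j.+2) //= (nth_map (fun=> 0)) -?(eqP size_ls).
Qed.

Lemma small_weaken (f : X -> nat) : small f -> @small ext (fun y => f (tag y)).
Proof. by move=> [comp_f le_f]; split=> [|y]; [exact: computable_weaken|exact: le_f]. Qed.

Lemma computable_idx : @computable ext (fun y => ext_idx y).
Proof. exact: (@computable_var ext 1). Qed.

Lemma computable_acc : @computable ext ext_acc.
Proof. exact: (@computable_var ext 0). Qed.

Hypothesis small_b : small b.

Lemma small_idxS : @small ext (fun y => (ext_idx y).+1).
Proof.
split=> [|[x [i a]]]; first exact/computable_succ/computable_idx.
exact: leq_trans (ltn_ord i) (small_bounded small_b x).
Qed.

Lemma small_idx : @small ext (fun y => ext_idx y).
Proof.
by split=> [|y]; [exact: computable_idx | exact: ltnW (small_bounded small_idxS y)].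
Qed.

Lemma computable_iteri (f0 : X -> nat) (f : X -> nat -> nat -> nat) :
  computable f0 ->
  @computable ext (fun y => f (tag y) (ext_idx y) (ext_acc y)) ->
  computable (fun x => iteri (b x) (f x) (f0 x)).
Proof.
move=> [comp_f0] [comp_f]; split=> ls s ls_s; have [size_ls ls_lt] := andP ls_s.
have [c0 [K0 run_f0]] := comp_f0 ls s ls_s.
have [cb [Kb run_b]] : exists (c : cmd) (K : nat), forall (x : X) m, stores ls x m ->
    runs (cinp x) (cbound x) K c m (fun m' => m' s.+1.*2 = b x /\ agree s.+1 m m').
  by case: small_b => -[comp_b] _; apply/comp_b/in_registersW/ls_s.
have [|cf [Kf run_f]] := comp_f (s :: s.+2 :: ls) s.+3.
  rewrite /in_registers /= size_map (eqP size_ls) eqxx /=; apply/and3P; split=> //.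
    by lia.
  by apply: sub_all ls_lt => r; lia.
exists (CSeq c0 (CSeq cb (for_loop s.+2 s.+1 (CSeq cf (set_reg s (reg s.+3))))));
  eexists=> x m sto.
apply: runs_seq (run_f0 x m sto) _ => m0 [acc0 mm0].
apply: runs_seq (run_b x m0 (stores_agree ls_s mm0 sto)) _ => m1 [bound1 m0m1].
pose inv i m' := m' s.*2 = iteri i (f x) (f0 x) /\ agree s m m'.
apply: (runs_for (I := inv) _ (small_bounded small_b x) bound1) => [|i m2 v|i m2 ib|].
- by rewrite ltn_eqF.
- move=> [acc2 mm2]; split; first by rewrite update_reg // ltn_eqF.
  by apply: agree_trans mm2 (agree_update _ _ _); rewrite -addn2 leq_addr.
- move=> [acc2 mm2] idx2; have [vars2 heap2] := stores_agree ls_s mm2 sto.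
  pose y : ext := Tagged (fun x => ('I_(b x) * nat)%type) (Ordinal ib, m2 s.*2).
  apply: (runs_seq (P := fun m' => m' s.+3.*2 = f x i (m2 s.*2) /\ agree s.+3 m2 m')).
    apply: (run_f y); split=> // -[|[|j]] //= j_lt.
    by rewrite vars2 // (nth_map (fun=> 0)) -?(eqP size_ls).
  move=> m3 [acc3 m2m3]; have [regs3 _] := m2m3; have s3 : s <= s.+3 by lia.
  apply: runs_set_reg; rewrite /inv update_same !update_reg ?gtn_eqF //= acc3 acc2.
  rewrite !regs3 // idx2; do 2!split=> //.
  exact: agree_trans mm2 (agree_trans (agreeW s3 m2m3) (agree_update _ _ _)).
split; first by case: m0m1 => ->.
exact: agree_trans mm0 (agreeW (leqnSn s) m0m1).
Qed.

Lemma computable_exists (p : forall x : X, 'I_(b x) -> bool) :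
  @computable ext (fun y => p (tag y) (ext_idx y)) ->
  computable (fun x => [exists i, p x i]).
Proof.
move=> comp_p; pose q x i := if insub i is Some j then p x j else false.
have comp_q : @computable ext
    (fun y => (ext_acc y != 0) || q (tag y) (val (ext_idx y))).
  apply: computable_orb; last first.
    by apply: computable_ext comp_p => y; rewrite /q valK.
  exact/computable_negb/(computable_eq computable_acc)/computable_const.
have := computable_iteri (f := fun x i a => (a != 0) || q x i)
  (computable_const X 0) comp_q.
apply: computable_ext => x.
have -> : [exists i, p x i] = has (q x) (iota 0 (b x)).
  apply/existsP/hasP => [[i p_i]|[i]].
    by exists (val i); rewrite ?mem_iota ?ltn_ord // /q valK.
  by rewrite /q; case: insubP => // j _ _ _ p_j; exists j.
elim: (b x) => [|k IH] //; rewrite [LHS]/= IH eqb0 negbK.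
by rewrite -(addn1 k) iotaD has_cat /= orbF.
Qed.

Lemma computable_forall (p : forall x : X, 'I_(b x) -> bool) :
  @computable ext (fun y => p (tag y) (ext_idx y)) ->
  computable (fun x => [forall i, p x i]).
Proof.
move=> /computable_negb comp_np.
have := computable_negb (computable_exists (p := fun x i => ~~ p x i) comp_np).
by apply: computable_ext => x; rewrite negb_exists; under eq_forallb do rewrite negbK.
Qed.

End Iteration.

Lemma small_pred (X : ctx) (f : X -> nat) : small f -> small (fun x => (f x).-1).
Proof.
move=> [comp_f le_f]; split=> [|x]; first exact: computable_pred.
exact: leq_trans (leq_pred _) (le_f x).
Qed.

Lemma computable_mul (X : ctx) (f g : X -> nat) : small f -> computable g ->
  computable (fun x => f x * g x).
Proof.
move=> small_f comp_g.
have comp_step : @computable (ext f) (fun y => g (tag y) + ext_acc y).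
  exact: computable_add (computable_weaken _ comp_g) (computable_acc _).
have := computable_iteri small_f (f := fun x _ a => g x + a)
  (computable_const X 0) comp_step.
apply: computable_ext => x.
by elim: (f x) => //= k ->; rewrite mulSn.
Qed.

Lemma computable_exp (X : ctx) (f g : X -> nat) :
  small f -> small g -> computable (fun x => f x ^ g x).
Proof.
move=> small_f small_g.
have comp_step : @computable (ext g) (fun y => f (tag y) * ext_acc y).
  exact: computable_mul (small_weaken _ small_f) (computable_acc _).
have := computable_iteri small_g (f := fun x _ a => f x * a)
  (computable_const X 1) comp_step.
apply: computable_ext => x.
by elim: (g x) => //= k ->; rewrite expnS.
Qed.

Lemma iteri_count_multiples a d k : 0 < d ->
  iteri k (fun i c => c + (i.+1 * d <= a)) 0 = minn k (a %/ d).
Proof.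
move=> d_gt0; elim: k => [|k IH]; first by rewrite min0n.
by rewrite [LHS]/= IH -leq_divRL //; move: (_ %/ _) => q; case: leqP; lia.
Qed.

Lemma computable_divn (X : ctx) (f g : X -> nat) :
  small f -> (forall x, 0 < g x) -> computable g ->
  computable (fun x => f x %/ g x).
Proof.
move=> small_f g_gt0 comp_g.
have comp_step : @computable (ext f)
    (fun y => ext_acc y + ((ext_idx y).+1 * g (tag y) <= f (tag y))).
  apply: computable_add (computable_acc _) _; apply: computable_leq.
    exact: computable_mul (small_idxS small_f) (computable_weaken _ comp_g).
  exact: computable_weaken small_f.
have := computable_iteri small_f (f := fun x i a => a + (i.+1 * g x <= f x))
  (computable_const X 0) comp_step.
by apply: computable_ext => x; rewrite iteri_count_multiples // (minn_idPr (leq_div _ _)).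
Qed.

Lemma computable_modn (X : ctx) (f g : X -> nat) :
  small f -> (forall x, 0 < g x) -> computable g ->
  computable (fun x => f x %% g x).
Proof.
move=> small_f g_gt0 comp_g.
have small_div : small (fun x => f x %/ g x).
  split=> [|x]; first exact: computable_divn.
  exact: leq_trans (leq_div _ _) (small_bounded small_f x).
have := computable_sub small_f (computable_mul small_div comp_g).
by apply: computable_ext => x; rewrite {1}(divn_eq (f x) (g x)) addnC addnK.
Qed.

Section Filling.
Variables (X : ctx) (heap_size : X -> nat).

Definition fill_sort := {x : X & ((nat -> nat) * 'I_(heap_size x))%type}.
Definition fill_heap (y : fill_sort) : nat -> nat := (tagged y).1.
Definition fill_addr (y : fill_sort) : 'I_(heap_size (tag y)) := (tagged y).2.

Definition fill_ctx : ctx :=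
  @Ctx fill_sort (fun y => cinp (tag y)) fill_heap (fun y => cbound (tag y))
    [:: (fun y => nat_of_ord (fill_addr y))
      & [seq (fun y : fill_sort => f (tag y)) | f <- cvars X]].

Hypothesis small_heap_size : small heap_size.

Lemma small_fill_addr : @small fill_ctx (fun y => fill_addr y).
Proof.
split=> [|[x [h a]]]; first exact: (@computable_var fill_ctx 0).
exact: leq_trans (ltnW (ltn_ord a)) (small_bounded small_heap_size x).
Qed.

Lemma fill_program (step : X -> (nat -> nat) -> nat -> nat) (cells : X -> nat -> nat) :
  @computable fill_ctx (fun y => step (tag y) (fill_heap y) (fill_addr y)) ->
  (forall x h a, a < heap_size x -> (forall a0, a0 < a -> h a0 = cells x a0) ->
     step x h a = cells x a) ->
  forall ls s, in_registers X ls s ->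
  exists (c : cmd) (K : nat), forall (x : X) m, stores ls x m ->
  runs (cinp x) (cbound x) K c m (fun m' =>
    (forall r, r < s -> m' r.*2 = m r.*2) /\
    forall a, a < heap_size x -> m' a.*2.+1 = cells x a).
Proof.
move=> [comp_step] stepE ls s ls_s; have [size_ls ls_lt] := andP ls_s.
have [cs [Ks run_s]] : exists (c : cmd) (K : nat), forall (x : X) m, stores ls x m ->
    runs (cinp x) (cbound x) K c m (fun m' => m' s.*2 = heap_size x /\ agree s m m').
  by case: small_heap_size => -[comp_heap_size] _; apply: comp_heap_size.
have [|cf [Kf run_f]] := comp_step (s.+1 :: ls) s.+2.
  rewrite /in_registers /= size_map (eqP size_ls) eqxx ltnSn /=.
  by apply: sub_all ls_lt => r; lia.
exists (CSeq cs (for_loop s.+1 s (CSeq cf (set_heap (reg s.+1) (reg s.+2)))));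
  eexists=> x m sto; apply: runs_seq (run_s x m sto) _ => m1 [limit1 [regs1 _]].
pose inv i m' := (forall r, r < s -> m' r.*2 = m r.*2) /\
  forall a, a < i -> m' a.*2.+1 = cells x a.
have limit_le := small_bounded small_heap_size x.
apply: (runs_for (I := inv) _ limit_le limit1) => [|i m2 v|i m2 i_lt|].
- by rewrite ltn_eqF.
- move=> [regs2 heap2]; split=> [r r_lt|a a_lt]; last by rewrite update_reg_heap heap2.
  by rewrite update_reg ?regs2 // ltn_eqF // leqW.
- move=> [regs2 heap2] idx2; pose y : fill_ctx :=
    Tagged (fun x => ((nat -> nat) * 'I_(heap_size x))%type)
      ((fun a => m2 a.*2.+1), Ordinal i_lt).
  apply: (runs_seq (P := fun m' => m' s.+2.*2 = cells x i /\ agree s.+2 m2 m')).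
    apply: runsW (run_f y m2 _) => // [m' []|]; first by rewrite stepE.
    have [vars_m _] := sto; split=> // -[|j] //= j_lt.
    rewrite regs2 ?vars_m ?(nth_map (fun=> 0)) -?(eqP size_ls) //.
    by apply: (allP ls_lt); apply: mem_nth.
  move=> m3 [cell3 [regs3 heap3]]; have idx3 : m3 s.+1.*2 = i by rewrite regs3.
  apply: runs_set_heap; rewrite /= idx3 cell3; split; last first.
  + by rewrite update_heap_reg.
  + by rewrite update_heap_reg regs3.
  split=> [r r_lt|a]; first by rewrite update_heap_reg regs3 ?regs2 // !leqW.
  rewrite ltnS leq_eqVlt => /orP[/eqP->|a_lt]; first by rewrite update_same.
  by rewrite update_neq ?heap3 ?heap2 // eqSS (inj_eq double_inj) ltn_eqF.
by split=> // r r_lt; rewrite regs1.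
Qed.

End Filling.

(** * Positional notation *)

Definition digit (b x j : nat) := x %/ b ^ j %% b.

Definition pack (b : nat) (s : seq nat) : nat := foldr (fun d x => b * x + d) 0 s.

Lemma digit_lt b x j : 0 < b -> digit b x j < b.
Proof. exact: ltn_pmod. Qed.

Lemma digit0 b x d : d < b -> digit b (b * x + d) 0 = d.
Proof. by move=> d_lt; rewrite /digit divn1 mulnC modnMDl modn_small. Qed.

Lemma digitS b x d j : d < b -> digit b (b * x + d) j.+1 = digit b x j.
Proof.
move=> d_lt; have b_gt0 : 0 < b by apply: leq_ltn_trans d_lt.
by rewrite /digit expnS divnMA mulnC divnMDl // (divn_small d_lt) addn0.
Qed.

Lemma digit_pack b s j : all (ltn^~ b) s -> j < size s ->
  digit b (pack b s) j = nth 0 s j.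
Proof.
elim: s j => [//|d s IH] [|j] /= /andP[d_lt s_lt] j_lt; first exact: digit0.
by rewrite digitS // IH.
Qed.

Lemma pack_digits b k x : x < b ^ k -> pack b (mkseq (digit b x) k) = x.
Proof.
elim: k x => [|k IH] x; first by rewrite ltnS leqn0 => /eqP->.
case: b IH => [|b] IH x_lt; first by rewrite exp0n in x_lt.
have -> : mkseq (digit b.+1 x) k.+1 = x %% b.+1 :: mkseq (digit b.+1 (x %/ b.+1)) k.
  rewrite /mkseq /= {1}/digit divn1 (iotaDl 1 0) -map_comp; congr cons.
  by apply: eq_map => j; rewrite /digit /= expnS divnMA.
by rewrite /= IH ?ltn_divLR // -?expnSr // mulnC -divn_eq.
Qed.

Lemma ltn_mulD b x y d d' : d < b -> x < y -> b * x + d < b * y + d'.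
Proof.
move=> d_lt xy; apply: (@leq_trans (b * x.+1)); first by rewrite mulnS addnC ltn_add2r.
by apply: leq_trans (leq_addr _ _); rewrite leq_mul2l xy orbT.
Qed.

Lemma pack_lt b s : all (ltn^~ b) s -> pack b s < b ^ size s.
Proof.
elim: s => //= d s IH /andP[d_lt /IH s_lt].
by rewrite expnS -[ltnRHS]addn0; apply: ltn_mulD.
Qed.

Lemma digit_max b k j : 0 < b -> j < k -> digit b (b ^ k).-1 j = b.-1.
Proof.
case: b => // b _; elim: k j => // k IH j j_lt.
have -> : (b.+1 ^ k.+1).-1 = b.+1 * (b.+1 ^ k).-1 + b.
  by rewrite expnS; case: (b.+1 ^ k) (expn_gt0 b.+1 k) => // x _; rewrite mulnS; lia.
by case: j j_lt => [|j] j_lt; rewrite ?digit0 ?digitS // IH.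
Qed.

(** * The dynamic program *)

Section Program.
Variables (n m : nat) (g : rel nat).

(* A vertex code packs four digits v, x, p, s in base n.+1: the vertex v lies on
   the path starting at x, where p precedes and s follows v; p = v at the start
   and s = v at the end of a path. The digit v = n stands for no vertex. *)
Definition code_base := n.+1 ^ 4.
Definition vertex_code v x p s := pack n.+1 [:: v; x; p; s].
Definition code_vertex q := digit n.+1 q 0.
Definition code_start q := digit n.+1 q 1.
Definition code_pred q := digit n.+1 q 2.
Definition code_succ q := digit n.+1 q 3.
Definition empty_code := code_base.-1.

(* A bag packs m.+1 vertex codes; the one at position 0 is its head. *)
Definition bag_bound := code_base ^ m.+1.
Definition bag_code Z j := digit code_base Z j.
Definition bag_vertex Z j := code_vertex (bag_code Z j).
Definition in_bag Z u := [exists j : 'I_m.+1, bag_vertex Z j == u].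
Definition in_tail Z u := [exists j : 'I_m, bag_vertex Z j.+1 == u].
Definition empty_bag := bag_bound.-1.

Definition reach_base i u Z := [&& i == u, u < n & ~~ in_bag Z u].

Definition reach_step (R : nat -> bool) u Z :=
  R u || [&& u < n, ~~ in_bag Z u & [exists v : 'I_n, R v && g v u]].

(* There is a walk of length at most s from i to u that avoids the bag Z. *)
Fixpoint reach s i u Z :=
  if s is s'.+1 then reach_step (fun v => reach s' i v Z) u Z
  else reach_base i u Z.

Definition is_start q := code_pred q == code_vertex q.

Definition pred_compatible q q' :=
  (code_pred q == code_vertex q') && (code_vertex q' != code_vertex q) ==>
  (code_start q' == code_start q) && (code_succ q' == code_vertex q).

Definition succ_compatible q q' :=
  (code_succ q == code_vertex q') && (code_vertex q' != code_vertex q) ==>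
  (code_start q' == code_start q) && (code_pred q' == code_vertex q).

Definition compatible q q' := pred_compatible q q' && succ_compatible q q'.

Definition mutually_compatible q q' := compatible q q' && compatible q' q.

Definition consistent Z :=
  [forall j : 'I_m.+1, forall j' : 'I_m.+1,
    (bag_vertex Z j == bag_vertex Z j') ==> (bag_code Z j == bag_code Z j')].

Section Oracle.
Variable R : nat -> nat -> nat -> nat -> bool.

Definition closer x p v :=
  [exists s : 'I_n, R s x p empty_bag && ~~ R s x v empty_bag].

Definition admissible q :=
  ((is_start q && (code_start q == code_vertex q)) ||
   (g (code_pred q) (code_vertex q) &&
    closer (code_start q) (code_pred q) (code_vertex q))) &&
  ((code_succ q == code_vertex q) || g (code_vertex q) (code_succ q)).

Definition near_head Z u := (bag_vertex Z 0 == n) || g u (bag_vertex Z 0).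

Definition touches Z i := [exists u : 'I_n, R n i u Z && near_head Z u].

(* i is the least vertex of a component that touches the head of Z. *)
Definition fresh Z i := touches Z i && ~~ [exists i' : 'I_n, (i' < i) && R n i' i Z].

Definition tail_codes_in Z Z' :=
  [forall j : 'I_m, exists j' : 'I_m.+1, bag_code Z' j.+1 == bag_code Z j'].

Definition boundary_in_tail Z i Z' :=
  [forall u : 'I_n, R n i u Z ==>
    [forall z : 'I_n, g u z ==> (R n i z Z || in_tail Z' z)]].

Definition link Z i Z' :=
  [&& R n i (bag_vertex Z' 0) Z, admissible (bag_code Z' 0),
      [forall j : 'I_m, mutually_compatible (bag_code Z' 0) (bag_code Z' j.+1)],
      tail_codes_in Z Z' & boundary_in_tail Z i Z'].

Definition table_step s i Z c (T : nat -> bool) (T' : nat -> nat -> bool) :=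
  if fresh Z i then
    (0 < s) && [exists c1 : 'I_n.+1, T c1 && [exists c2 : 'I_n.+1,
      [exists Z' : 'I_bag_bound,
        [&& T' c2 Z', c1 + c2 + is_start (bag_code Z' 0) == c & link Z i Z']]]]
  else T c.

Definition table_base Z c := (c == 0) && consistent Z.

(* The components of the graph without Z that touch the head of Z and contain a
   vertex below i have a valid labelling that extends Z and has c path starts,
   with bags nested at most s deep. *)
Fixpoint table s := fix aux i Z c : bool :=
  if i is i'.+1 then
    table_step s i' Z c (fun c1 => aux i' Z c1)
      (fun c2 Z' => if s is s'.+1 then table s' n Z' c2 else false)
  else table_base Z c.

Lemma table0 s Z c : table s 0 Z c = table_base Z c.
Proof. by case: s. Qed.

Lemma tableS s i Z c : table s i.+1 Z c =
  table_step s i Z c (fun c1 => table s i Z c1)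
    (fun c2 Z' => if s is s'.+1 then table s' n Z' c2 else false).
Proof. by case: s. Qed.

End Oracle.

Lemma code_base_gt0 : 0 < code_base. Proof. by rewrite expn_gt0. Qed.

Lemma bag_bound_gt0 : 0 < bag_bound.
Proof. by rewrite expn_gt0 code_base_gt0. Qed.

Lemma leq_code_bag_bound : code_base <= bag_bound.
Proof. by rewrite /bag_bound expnS leq_pmulr // expn_gt0 code_base_gt0. Qed.

Lemma ltn_n_code_base : n < code_base.
Proof. by rewrite /code_base expnS leq_pmulr // expn_gt0. Qed.

Lemma ltn_bag_bound x : x <= n -> x < bag_bound.
Proof.
by move=> x_le; apply: leq_trans leq_code_bag_bound; apply: leq_ltn_trans ltn_n_code_base.
Qed.

Lemma code_vertex_le q : code_vertex q <= n.
Proof. by rewrite -ltnS; apply: digit_lt. Qed.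

(** * The order of evaluation *)

Definition in_range s i u Z :=
  [&& s < bag_bound, i < bag_bound, u < bag_bound & Z < bag_bound].

Definition addr k s i c Z := pack bag_bound [:: Z; c; i; s; k].

Definition addr_kind a := digit bag_bound a 4.
Definition addr_round a := digit bag_bound a 3.
Definition addr_idx a := digit bag_bound a 2.
Definition addr_val a := digit bag_bound a 1.
Definition addr_bag a := digit bag_bound a 0.

Definition ranged_reach s i u Z := in_range s i u Z && reach s i u Z.

(* Cells of kind 0 hold reach, all others hold table. *)
Definition cell_value k s i c Z : bool :=
  if k == 0 then reach s i c Z else table ranged_reach s i Z c.

Definition cell (a : nat) : bool :=
  cell_value (addr_kind a) (addr_round a) (addr_idx a) (addr_val a) (addr_bag a).

Section Step.
Variable h : nat -> nat.

Definition heap_reach s i u Z := in_range s i u Z && (h (addr 0 s i u Z) != 0).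

Definition reach_cell_step s i u Z :=
  if s == 0 then reach_base i u Z
  else reach_step (fun v => heap_reach s.-1 i v Z) u Z.

Definition table_cell_step s i c Z :=
  if i == 0 then table_base Z c
  else table_step heap_reach s i.-1 Z c
    (fun c1 => h (addr 1 s i.-1 c1 Z) != 0)
    (fun c2 Z' => h (addr 1 s.-1 n c2 Z') != 0).

Definition cell_step (a : nat) : bool :=
  if addr_kind a == 0 then
    reach_cell_step (addr_round a) (addr_idx a) (addr_val a) (addr_bag a)
  else table_cell_step (addr_round a) (addr_idx a) (addr_val a) (addr_bag a).

End Step.

Definition cell_count := bag_bound ^ 5.

Lemma addr_digits a : a < cell_count ->
  addr (addr_kind a) (addr_round a) (addr_idx a) (addr_val a) (addr_bag a) = a.
Proof. exact: pack_digits. Qed.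

Lemma addr_lt k s i c Z : in_range s i c Z -> k < bag_bound ->
  addr k s i c Z < cell_count.
Proof.
move=> /and4P[s_lt i_lt c_lt Z_lt] k_lt.
by apply: (@pack_lt _ [:: Z; c; i; s; k]); rewrite /= Z_lt c_lt i_lt s_lt k_lt.
Qed.

Lemma cell_addr k s i c Z : in_range s i c Z -> k < bag_bound ->
  cell (addr k s i c Z) = cell_value k s i c Z.
Proof.
move=> /and4P[s_lt i_lt c_lt Z_lt] k_lt.
have digitE j : j < 5 -> digit bag_bound (addr k s i c Z) j = nth 0 [:: Z; c; i; s; k] j.
  by move=> j_lt; apply: digit_pack; rewrite //= Z_lt c_lt i_lt s_lt k_lt.
by rewrite /cell /addr_kind /addr_round /addr_idx /addr_val /addr_bag !digitE.
Qed.

Lemma ltn_addr k s i c Z k' s' i' c' Z' : in_range s i c Z ->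
  (k < k') || (k == k') && ((s < s') || (s == s') && (i < i')) ->
  addr k s i c Z < addr k' s' i' c' Z'.
Proof.
move=> /and4P[s_lt i_lt c_lt Z_lt] lex; rewrite /addr /=; do 2!apply: ltn_mulD => //.
case/orP: lex => [kk'|/andP[/eqP<- /orP[ss'|/andP[/eqP<- ii']]]].
- by do 2!apply: ltn_mulD => //; rewrite !muln0.
- by apply: ltn_mulD => //; rewrite !muln0 ltn_add2l.
- by rewrite ltn_add2l.
Qed.

Section CellStepCorrect.
Variables (h : nat -> nat) (a : nat).
Hypothesis h_below : forall a0, a0 < a -> h a0 = cell a0.

Lemma read_cell k s i c Z : in_range s i c Z -> k < bag_bound ->
  addr k s i c Z < a -> (h (addr k s i c Z) != 0) = cell_value k s i c Z.
Proof. by move=> ran k_lt lt_a; rewrite h_below // cell_addr // eqb0 negbK. Qed.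

Lemma heap_reach_below s i u Z :
  (in_range s i u Z -> addr 0 s i u Z < a) -> heap_reach h s i u Z = ranged_reach s i u Z.
Proof.
rewrite /heap_reach /ranged_reach => lt_a; case ran: in_range => //=.
by rewrite read_cell ?bag_bound_gt0 ?lt_a.
Qed.

Lemma reach_cell_step_correct s i u Z : in_range s i u Z -> a = addr 0 s i u Z ->
  reach_cell_step h s i u Z = reach s i u Z.
Proof.
case: s => [|s] //= /and4P[s_lt i_lt u_lt Z_lt] aE; rewrite /reach_cell_step /=.
have readE v : v < bag_bound -> heap_reach h s i v Z = reach s i v Z.
  move=> v_lt; rewrite heap_reach_below => [|ran].
    by rewrite /ranged_reach /in_range (ltnW s_lt) i_lt v_lt Z_lt.
  by rewrite aE; apply: ltn_addr => //; lia.
rewrite /reach_step readE //; congr (_ || [&& _, _ & _]).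
by apply: eq_existsb => v; rewrite readE // ltn_bag_bound // ltnW.
Qed.

Lemma eq_table_step R s i Z c T U T' U' : c < bag_bound ->
  (forall c1, c1 < bag_bound -> T c1 = U c1) ->
  (0 < s -> forall c2 Z', c2 < bag_bound -> Z' < bag_bound -> T' c2 Z' = U' c2 Z') ->
  table_step R s i Z c T T' = table_step R s i Z c U U'.
Proof.
move=> c_lt TU TU'; rewrite /table_step TU //; case: fresh => //.
have ord_lt (c0 : 'I_n.+1) : c0 < bag_bound by apply: ltn_bag_bound; rewrite -ltnS.
case: posnP => // s_gt0; rewrite !andTb; apply: eq_existsb => c1; rewrite TU //.
congr andb; apply: eq_existsb => c2; apply: eq_existsb => Z'.
by rewrite TU' // ltn_ord.
Qed.

Lemma table_cell_step_correct k s i c Z : in_range s i c Z -> 0 < k < bag_bound ->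
  a = addr k s i c Z -> table_cell_step h s i c Z = table ranged_reach s i Z c.
Proof.
move=> ran /andP[k_gt0 k_lt] aE; have [s_lt i_lt c_lt Z_lt] := and4P ran.
have reachE : heap_reach h = ranged_reach.
  apply/funext => s'; apply/funext => i'; apply/funext => u; apply/funext => Y.
  by apply: heap_reach_below => ran'; rewrite aE; apply: ltn_addr; rewrite ?k_gt0.
have readE s' i' c' Y : in_range s' i' c' Y -> (s' < s) || (s' == s) && (i' < i) ->
    (h (addr 1 s' i' c' Y) != 0) = table ranged_reach s' i' Y c'.
  move=> ran' lex; rewrite read_cell ?(leq_ltn_trans k_gt0) //.
  by rewrite aE; apply: ltn_addr => //; lia.
case: i i_lt {aE ran} readE => [|i] i_lt readE; first by rewrite table0.
rewrite tableS /table_cell_step /= reachE.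
apply: eq_table_step => // [c1 c1_lt|s_gt0 c2 Y c2_lt Y_lt].
  by rewrite readE ?ltnSn ?eqxx ?orbT // /in_range s_lt (ltnW i_lt) c1_lt.
case: s s_gt0 s_lt readE => //= s _ s_lt readE.
by rewrite readE ?ltnSn // /in_range (ltnW s_lt) ltn_bag_bound // c2_lt.
Qed.

Lemma cell_step_correct : a < cell_count -> cell_step h a = cell a.
Proof.
move=> /addr_digits aE; rewrite /cell_step /cell /cell_value.
have ran : in_range (addr_round a) (addr_idx a) (addr_val a) (addr_bag a).
  by apply/and4P; split; apply/digit_lt/bag_bound_gt0.
case: eqVneq aE => [-> aE|k_neq0 aE]; first exact: reach_cell_step_correct.
apply: (@table_cell_step_correct (addr_kind a)) => //.
by rewrite lt0n k_neq0; apply/digit_lt/bag_bound_gt0.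
Qed.

End CellStepCorrect.
End Program.

(** * The dynamic program on the machine *)

Definition input_adj (inp : seq nat) (u v : nat) : bool :=
  [exists e : 'I_(nth 0 inp 2),
    ((nth 0 inp (3 + (e + e)) == u) && (nth 0 inp (4 + (e + e)) == v)) ||
    ((nth 0 inp (3 + (e + e)) == v) && (nth 0 inp (4 + (e + e)) == u))].

Definition vertex_count (X : ctx) (x : X) : nat := nth 0 (cinp x) 0.

Record sized_ctx := SizedCtx {
  sctx :> ctx;
  ctx_width : sctx -> nat;
  computable_ctx_width : computable ctx_width;
  vertex_count_gt0 : forall x : sctx, 0 < vertex_count x;
  edges_bounded : bounded (fun x : sctx => nth 0 (cinp x) 2);
  cells_bounded : bounded (fun x : sctx => cell_count (vertex_count x) (ctx_width x)) }.

Canonical sized_ext (X : sized_ctx) (b : X -> nat) : sized_ctx :=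
  @SizedCtx (ext b) (fun y => ctx_width (tag y))
    (computable_weaken b (computable_ctx_width X)) (fun y => vertex_count_gt0 (tag y))
    (fun y => edges_bounded (tag y)) (fun y => cells_bounded (tag y)).

Lemma computable_vertex_count (X : ctx) : computable (@vertex_count X).
Proof. exact/computable_input/computable_const. Qed.

Section Sizes.
Variable X : sized_ctx.

Lemma code_base_ge16 (x : X) : 16 <= code_base (vertex_count x).
Proof. by rewrite (@leq_exp2r 2 (vertex_count x).+1 4) // ltnS vertex_count_gt0. Qed.

Lemma bag_bound_bounded : bounded (fun x : X => bag_bound (vertex_count x) (ctx_width x)).
Proof.
move=> x; apply: leq_trans (cells_bounded x); rewrite /cell_count expnS leq_pmulr //.
by rewrite expn_gt0 bag_bound_gt0.
Qed.

Lemma code_base_bounded : bounded (fun x : X => code_base (vertex_count x)).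
Proof. by move=> x; apply: leq_trans (leq_code_bag_bound _ _) (bag_bound_bounded x). Qed.

Lemma small_const v : v <= 16 -> small (fun _ : X => v).
Proof.
move=> v_le; split=> [|x]; first exact: computable_const.
exact: leq_trans v_le (leq_trans (code_base_ge16 x) (code_base_bounded x)).
Qed.

Lemma small_vertex_countS : small (fun x : X => (vertex_count x).+1).
Proof.
split=> [|x]; first exact/computable_succ/computable_vertex_count.
exact: leq_trans (ltn_n_code_base _) (code_base_bounded x).
Qed.

Lemma small_vertex_count : small (@vertex_count X).
Proof. by have := small_pred small_vertex_countS. Qed.

Lemma small_code_base : small (fun x : X => code_base (vertex_count x)).
Proof.
split; last exact: code_base_bounded.
exact: computable_exp small_vertex_countS (small_const _).
Qed.

Lemma small_ctx_widthS : small (fun x : X => (ctx_width x).+1).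
Proof.
split=> [|x]; first exact/computable_succ/computable_ctx_width.
apply: leq_trans (bag_bound_bounded x); apply/ltnW/ltn_expl.
exact: leq_trans (code_base_ge16 x).
Qed.

Lemma small_ctx_width : small (@ctx_width X).
Proof. by have := small_pred small_ctx_widthS. Qed.

Lemma small_bag_bound : small (fun x : X => bag_bound (vertex_count x) (ctx_width x)).
Proof.
split; last exact: bag_bound_bounded.
exact: computable_exp small_code_base small_ctx_widthS.
Qed.

End Sizes.

Lemma small_digit (X : ctx) (b f j : X -> nat) :
  small b -> (forall x, 0 < b x) -> small f -> small j ->
  small (fun x => digit (b x) (f x) (j x)).
Proof.
move=> small_b b_gt0 small_f small_j; split=> [|x]; last first.
  by apply: leq_trans (small_bounded small_b x); apply/ltnW/digit_lt.
apply: computable_modn => //; last exact: small_b.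
split=> [|x].
  apply: computable_divn => //; first by move=> x; rewrite expn_gt0 b_gt0.
  exact: computable_exp.
exact: leq_trans (leq_div _ _) (small_bounded small_f x).
Qed.

Lemma small_code_digit (X : sized_ctx) (q j : X -> nat) : small q -> small j ->
  small (fun x => digit (vertex_count x).+1 (q x) (j x)).
Proof. by move=> *; apply: small_digit => //; apply: small_vertex_countS. Qed.

Lemma small_bag_digit (X : sized_ctx) (f j : X -> nat) : small f -> small j ->
  small (fun x => digit (bag_bound (vertex_count x) (ctx_width x)) (f x) (j x)).
Proof.
move=> *; apply: small_digit => //; first exact: small_bag_bound.
by move=> x; apply: bag_bound_gt0.
Qed.

Lemma small_bag_code (X : sized_ctx) (Z j : X -> nat) : small Z -> small j ->
  small (fun x => bag_code (vertex_count x) (Z x) (j x)).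
Proof. by move=> *; apply: small_digit => //; apply: small_code_base. Qed.

Lemma small_bag_vertex (X : sized_ctx) (Z j : X -> nat) : small Z -> small j ->
  small (fun x => bag_vertex (vertex_count x) (Z x) (j x)).
Proof.
by move=> *; apply: small_code_digit; [exact: small_bag_code | exact: small_const].
Qed.

Lemma small_empty_bag (X : sized_ctx) :
  small (fun x : X => empty_bag (vertex_count x) (ctx_width x)).
Proof. exact/small_pred/small_bag_bound. Qed.

(* Quantifiers nest at most three deep. *)
Ltac weaken_from weaken H :=
  first [ exact: H
        | exact: (weaken _ _ _ H)
        | exact: (weaken _ _ _ (weaken _ _ _ H))
        | exact: (weaken _ _ _ (weaken _ _ _ (weaken _ _ _ H))) ].

Ltac by_weakening :=
  match goal with
  | H : small _ |- small _ => weaken_from small_weaken H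
  | H : computable _ |- computable _ => weaken_from computable_weaken H
  end.

Ltac small_step :=
  lazymatch goal with
  | |- small (@vertex_count _) => exact: small_vertex_count
  | |- small (@ctx_width _) => exact: small_ctx_width
  | |- small (fun x => vertex_count _) => exact: small_vertex_count
  | |- small (fun x => ctx_width _) => exact: small_ctx_width
  | |- small (fun x => S (vertex_count _)) => exact: small_vertex_countS
  | |- small (fun x => S (ctx_width _)) => exact: small_ctx_widthS
  | |- small (fun x => bag_bound _ _) => exact: small_bag_bound
  | |- small (fun x => empty_bag _ _) => exact: small_empty_bag
  | |- small (fun x => digit (S (vertex_count _)) _ _) => apply: small_code_digit
  | |- small (fun x => digit (bag_bound _ _) _ _) => apply: small_bag_digit
  | |- small (fun x => bag_code _ _ _) => apply: small_bag_code
  | |- small (fun x => bag_vertex _ _ _) => apply: small_bag_vertex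
  | |- small (fun x => nat_of_ord (ext_idx x)) => apply: small_idx
  | |- small (fun x => nat_of_ord (ext_idx (tag x))) =>
      apply: (small_weaken _ (small_idx _))
  | |- small (fun x => S (nat_of_ord (ext_idx x))) => apply: small_idxS
  | |- small (fun x => S (nat_of_ord (ext_idx (tag x)))) =>
      apply: (small_weaken _ (small_idxS _))
  | |- small _ => first [by_weakening | exact: small_const]
  end.

Ltac computability_step :=
  lazymatch goal with
  | |- small _ => small_step
  | |- computable (fun x => nat_of_bool [exists _, _]) => apply: computable_exists
  | |- computable (fun x => nat_of_bool [forall _, _]) => apply: computable_forall
  | |- computable (fun x => nat_of_bool (~~ _)) => apply: computable_negb
  | |- computable (fun x => nat_of_bool (_ && _)) => apply: computable_andb
  | |- computable (fun x => nat_of_bool (_ || _)) => apply: computable_orb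
  | |- computable (fun x => nat_of_bool (_ ==> _)) => apply: computable_implyb
  | |- computable (fun x => nat_of_bool (if _ then _ else _)) => apply: computable_ifb
  | |- computable (fun x => nat_of_bool (_ == _)) => apply: computable_eq
  | |- computable (fun x => nat_of_bool (_ <= _)) => apply: computable_leq
  | |- computable (fun x => _ + _) => apply: computable_add
  | |- computable (fun x => _ * _) => apply: computable_mul
  | |- computable (fun x => S _) => apply: computable_succ
  | |- computable (fun x => predn _) => apply: computable_pred
  | |- computable (fun x => nth 0 (cinp _) _) => apply: computable_input
  | |- computable (fun x => cheap _ _) => apply: computable_heap
  | |- computable (fun x => nat_of_ord (ext_idx _)) =>
      first [ exact: computable_idx
            | exact: (computable_weaken _ (computable_idx _))
            | exact: (computable_weaken _ (computable_weaken _ (computable_idx _))) ]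
  | |- computable _ =>
      first [by_weakening | exact: computable_const | apply: small_computable]
  end.

Section Predicates.
Variable X : sized_ctx.
Local Notation n x := (vertex_count x).
Local Notation m x := (ctx_width x).
Local Notation adj x := (input_adj (cinp x)).
Implicit Types (x : X) (u v Z q k s i c : X -> nat).

Lemma small_edge_count : small (fun x => nth 0 (cinp x) 2).
Proof. by split; [repeat computability_step | exact: edges_bounded]. Qed.

Lemma computable_adj u v : computable u -> computable v ->
  computable (fun x => adj x (u x) (v x)).
Proof.
by have := small_edge_count; rewrite /input_adj => *; repeat computability_step.
Qed.

Lemma computable_in_bag Z u : small Z -> computable u ->
  computable (fun x => in_bag (n x) (m x) (Z x) (u x)).
Proof. by rewrite /in_bag => *; repeat computability_step. Qed.

Lemma computable_in_tail Z u : small Z -> computable u ->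
  computable (fun x => in_tail (n x) (m x) (Z x) (u x)).
Proof. by rewrite /in_tail => *; repeat computability_step. Qed.

Lemma computable_mutually_compatible q q' : small q -> small q' ->
  computable (fun x => mutually_compatible (n x) (q x) (q' x)).
Proof.
rewrite /mutually_compatible /compatible /pred_compatible /succ_compatible.
by rewrite /code_pred /code_start /code_succ /code_vertex => *; repeat computability_step.
Qed.

Lemma computable_addr k s i c Z : computable k -> computable s -> computable i ->
  computable c -> computable Z ->
  computable (fun x => addr (n x) (m x) (k x) (s x) (i x) (c x) (Z x)).
Proof. by rewrite /addr /= => *; repeat computability_step. Qed.

End Predicates.

Ltac program_step :=
  lazymatch goal with
  | |- computable (fun x => nat_of_bool (input_adj _ _ _)) => apply: computable_adj
  | |- computable (fun x => nat_of_bool (in_bag _ _ _ _)) => apply: computable_in_bag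
  | |- computable (fun x => nat_of_bool (in_tail _ _ _ _)) => apply: computable_in_tail
  | |- computable (fun x => nat_of_bool (mutually_compatible _ _ _)) =>
      apply: computable_mutually_compatible
  | |- computable (fun x => addr _ _ _ _ _ _ _) => apply: computable_addr
  | |- computable (fun x => nat_of_bool (near_head _ _ _ _)) => rewrite /near_head
  | |- computable (fun x => nat_of_bool (heap_reach _ _ _ _ _ _ _)) =>
      rewrite /heap_reach /in_range
  | |- computable (fun x => nat_of_bool (in_range _ _ _ _ _ _)) => rewrite /in_range
  | |- _ => computability_step
  end.

Section Oracle.
Variable X : sized_ctx.
Local Notation n x := (vertex_count x).
Local Notation m x := (ctx_width x).
Local Notation adj x := (input_adj (cinp x)).
Local Notation reached x := (heap_reach (n x) (m x) (cheap x)).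
Implicit Types (x : X) (s i u Z q : X -> nat).

Lemma computable_admissible q : small q ->
  computable (fun x => admissible (n x) (m x) (adj x) (reached x) (q x)).
Proof.
rewrite /admissible /closer /is_start /code_pred /code_start /code_succ /code_vertex.
by move=> *; repeat program_step.
Qed.

Lemma computable_fresh Z i : small Z -> computable i ->
  computable (fun x => fresh (n x) (adj x) (reached x) (Z x) (i x)).
Proof. by rewrite /fresh /touches /near_head => *; repeat program_step. Qed.

Lemma computable_tail_codes_in Z Z' : small Z -> small Z' ->
  computable (fun x => tail_codes_in (n x) (m x) (Z x) (Z' x)).
Proof. by rewrite /tail_codes_in => *; repeat program_step. Qed.

Lemma computable_boundary_in_tail Z i Z' : small Z -> computable i -> small Z' ->
  computable (fun x => boundary_in_tail (n x) (m x) (adj x) (reached x)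
    (Z x) (i x) (Z' x)).
Proof. by rewrite /boundary_in_tail => *; repeat program_step. Qed.

Lemma computable_reach_cell_step s i u Z : computable s -> computable i -> computable u ->
  small Z -> computable (fun x => reach_cell_step (n x) (m x) (adj x) (cheap x)
    (s x) (i x) (u x) (Z x)).
Proof.
by rewrite /reach_cell_step /reach_base /reach_step => *; repeat program_step.
Qed.

End Oracle.

Ltac oracle_step :=
  lazymatch goal with
  | |- computable (fun x => nat_of_bool (admissible _ _ _ _ _)) =>
      apply: computable_admissible
  | |- computable (fun x => nat_of_bool (fresh _ _ _ _ _)) => apply: computable_fresh
  | |- computable (fun x => nat_of_bool (tail_codes_in _ _ _ _)) =>
      apply: computable_tail_codes_in
  | |- computable (fun x => nat_of_bool (boundary_in_tail _ _ _ _ _ _ _)) =>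
      apply: computable_boundary_in_tail
  | |- _ => program_step
  end.

Lemma computable_link (X : sized_ctx) (Z i Z' : X -> nat) :
  small Z -> computable i -> small Z' ->
  computable (fun x => link (vertex_count x) (ctx_width x) (input_adj (cinp x))
    (heap_reach (vertex_count x) (ctx_width x) (cheap x)) (Z x) (i x) (Z' x)).
Proof. by rewrite /link => *; repeat oracle_step. Qed.

Ltac link_step :=
  lazymatch goal with
  | |- computable (fun x => nat_of_bool (link _ _ _ _ _ _ _)) => apply: computable_link
  | |- _ => oracle_step
  end.

Lemma computable_table_cell_step (X : sized_ctx) (s i c Z : X -> nat) :
  computable s -> computable i -> computable c -> small Z ->
  computable (fun x => table_cell_step (vertex_count x) (ctx_width x)
    (input_adj (cinp x)) (cheap x) (s x) (i x) (c x) (Z x)).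
Proof.
rewrite /table_cell_step /table_base /table_step /consistent /is_start.
by rewrite /code_pred /code_vertex => *; repeat link_step.
Qed.

Lemma computable_cell_step (X : sized_ctx) (a : X -> nat) : small a ->
  computable (fun x => cell_step (vertex_count x) (ctx_width x)
    (input_adj (cinp x)) (cheap x) (a x)).
Proof.
rewrite /cell_step /addr_kind /addr_round /addr_idx /addr_val /addr_bag => small_a.
apply: computable_ifb; first by repeat computability_step.
  by apply: computable_reach_cell_step; repeat computability_step.
by apply: computable_table_cell_step; repeat computability_step.
Qed.

(** * Components of induced subgraphs *)

Section Components.
Variables (V : finType) (G : sgraph V).
Implicit Types (S D : {set V}) (H : pred V) (x y u z : V).

Definition within S : rel V := [rel a b | [&& a \in S, b \in S & G a b]].

Definition connected_set S := {in S &, forall x y, connect (within S) x y}.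

Definition component S x := [set u | (x \in S) && connect (within S) x u].

Definition boundary D := [set z | (z \notin D) && [exists d in D, G d z]].

Definition attached S H := [set u | [exists y in component S u, H y]].

Lemma connect_within_sym S : connect_sym (within S).
Proof.
apply: sym_connect_sym => a b; rewrite /within /= adj_sym; exact: andbCA.
Qed.

Lemma connect_withinW S S' x y : S \subset S' ->
  connect (within S) x y -> connect (within S') x y.
Proof.
move=> /subsetP sub; apply: connect_sub => a b /and3P[aS bS ab].
by apply: connect1; rewrite /within /= !sub.
Qed.

Lemma component_subset S D x : x \in D ->
  (forall a b, a \in D -> b \in S -> G a b -> b \in D) -> component S x \subset D.
Proof.
move=> xD closed; apply/subsetP => u; rewrite inE => /andP[_ /connectP[p path_p ->]].
elim: p x xD path_p => //= y p IH x xD /andP[/and3P[_ yS xy]].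
exact/IH/(closed x).
Qed.

Lemma component_sub S x : component S x \subset S.
Proof.
apply/subsetP => u ux; have xS : x \in S by move: ux; rewrite inE => /andP[].
by apply: (subsetP (component_subset xS _) u ux) => a b.
Qed.

Lemma mem_component S x : (x \in component S x) = (x \in S).
Proof. by rewrite inE connect0 andbT. Qed.

Lemma component_sym S x u : (u \in component S x) = (x \in component S u).
Proof.
have sym a b : b \in component S a -> a \in component S b.
  move=> ba; have bS := subsetP (component_sub S a) b ba.
  by move: ba; rewrite !inE bS connect_within_sym => /andP[].
by apply/idP/idP; apply: sym.
Qed.

Lemma component_trans S x u : u \in component S x -> component S u \subset component S x.
Proof.
rewrite inE => /andP[xS xu]; apply/subsetP => v; rewrite !inE xS => /andP[_].
exact: connect_trans.
Qed.

Lemma component_eq S x u : u \in component S x -> component S u = component S x.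
Proof.
move=> ux; apply/eqP; rewrite eqEsubset component_trans //=.
by apply: component_trans; rewrite component_sym.
Qed.

Lemma component_mono S S' x : S \subset S' -> component S x \subset component S' x.
Proof.
move=> sub; apply/subsetP => u; rewrite !inE => /andP[xS xu].
by rewrite (subsetP sub) //=; apply: connect_withinW xu.
Qed.

Lemma component_edge S x u z : u \in component S x -> G u z -> z \in S ->
  z \in component S x.
Proof.
move=> ux uz zS; have uS := subsetP (component_sub S x) u ux.
move: ux; rewrite !inE => /andP[-> /= xu]; apply: connect_trans xu (connect1 _).
by rewrite /within /= uS zS.
Qed.

Lemma component_connected S x : connected_set (component S x).
Proof.
move=> u v ux vx; have : v \in component S u by rewrite (component_eq ux).
rewrite inE => /andP[_ /connectP[p path_p ->]] {v vx}.
elim: p u ux path_p => [|z p IH] u ux //= /andP[/and3P[_ zS uz] path_p].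
have zx := component_edge ux uz zS; apply: connect_trans (IH z zx path_p).
by apply: connect1; rewrite /within /= ux zx.
Qed.

Lemma connected_sub_component S D x : connected_set D -> D \subset S -> x \in D ->
  D \subset component S x.
Proof.
move=> D_conn sub xD; apply/subsetP => u uD; rewrite inE (subsetP sub) //=.
exact: connect_withinW sub (D_conn _ _ xD uD).
Qed.

Lemma mem_boundary D d z : d \in D -> G d z -> z \notin D -> z \in boundary D.
Proof. by move=> dD dz zD; rewrite inE zD; apply/existsP; exists d; rewrite dD. Qed.

Lemma boundaryP D z :
  reflect (z \notin D /\ exists2 d, d \in D & G d z) (z \in boundary D).
Proof.
rewrite inE; apply: (iffP andP) => -[zD].
  by case/exists_inP=> d; split; last exists d.
by case=> d dD dz; split=> //; apply/exists_inP; exists d.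
Qed.

Lemma component_boundary S x z : z \in boundary (component S x) -> z \notin S.
Proof. by case/boundaryP=> zC [d dC dz]; apply: contra zC; apply: component_edge dz. Qed.

Lemma mem_boundary_component S s t : connected_set S -> s \in S -> t \in S ->
  s != t -> t \in boundary (component (S :\ t) s).
Proof.
move=> S_conn sS tS st; set C := component (S :\ t) s.
have sC : s \in C by rewrite mem_component !inE st.
have tC : t \notin C.
  by apply/negP => /(subsetP (component_sub _ _)); rewrite !inE eqxx.
have : t \in component S s by rewrite inE sS S_conn.
apply: contraTT => t_bd; suff /subsetP sub : component S s \subset C.
  by apply: contra tC; apply: sub.
apply: component_subset sC _ => a b aC bS ab; apply: (component_edge aC ab).
rewrite !inE bS andbT; apply: contraNneq t_bd => bt.
by rewrite bt in ab; apply: mem_boundary aC ab tC.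
Qed.

Lemma attachedP S H u :
  reflect (exists2 y, y \in component S u & H y) (u \in attached S H).
Proof. by rewrite inE; apply: exists_inP. Qed.

Lemma attached_sub S H : attached S H \subset S.
Proof.
apply/subsetP => u /attachedP[y].
by rewrite component_sym => /(subsetP (component_sub _ _)).
Qed.

Lemma attached_component S H x u : u \in component S x ->
  (u \in attached S H) = (x \in attached S H).
Proof. by move=> ux; rewrite !inE (component_eq ux). Qed.

Lemma component_sub_attached S H x :
  x \in attached S H -> component S x \subset attached S H.
Proof. by move=> xH; apply/subsetP => u /attached_component->. Qed.

(* S and S' are the vertices outside the old and the new bag, and u is the head
   of the new one. *)
Lemma component_split S S' x u : u \in component S x -> u \notin S' ->
  S \subset u |: S' -> {in boundary (component S x), forall z, z \notin S'} ->
  component S x = u |: attached S' (G u).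
Proof.
set C := component S x => uC uS' sub bdC.
apply/eqP; rewrite eqEsubset; apply/andP; split; last first.
  rewrite subUset sub1set uC; apply/subsetP => v /attachedP[y yv uy].
  have yS' := subsetP (component_sub S' v) y yv.
  have closed a b : a \in C -> b \in S' -> G a b -> b \in C.
    by move=> aC + ab; apply: contraLR => bC; apply/bdC/(mem_boundary aC ab).
  apply: (subsetP (component_subset (closed u y uC yS' uy) closed)).
  by rewrite component_sym.
rewrite -[C](component_eq uC); apply: component_subset; first exact: setU11.
move=> a b aA bS ab; case: (setU1P (subsetP sub b bS)) => [->|bS']; first exact: setU11.
apply: setU1r; case/setU1P: aA => [au|aA].
  by apply/attachedP; exists b; rewrite ?mem_component // -au.
have aS' := subsetP (attached_sub S' (G u)) a aA.
by rewrite (@attached_component _ _ a) ?(component_edge _ ab) ?mem_component.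
Qed.

Definition dominated (key : V -> nat) D :=
  {in boundary D & D, forall z x, key x <= key z}.

Definition elimination_key (w : nat) (key : V -> nat) :=
  forall D, D != set0 -> connected_set D -> dominated key D -> #|boundary D| <= w.

End Components.

(** * Processing the components in the order of their least vertices *)

Section Processed.
Variables (n : nat) (G : sgraph 'I_n) (S : {set 'I_n}) (H : pred 'I_n).
Implicit Types i u z : 'I_n.
Local Notation component := (component G S).
Local Notation attached := (attached G S H).

Definition processed (k : nat) :=
  [set u in attached | [exists i : 'I_n, (i < k) && (u \in component i)]].

Definition leader i :=
  (i \in attached) && ~~ [exists i' : 'I_n, (i' < i) && (i \in component i')].

Lemma processedP k u :
  reflect (u \in attached /\ exists2 i : 'I_n, i < k & u \in component i)
          (u \in processed k).
Proof.
rewrite [u \in processed k]in_set; apply: (iffP andP) => -[uH].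
  by case/existsP=> i /andP[ik ui]; split; last exists i.
by case=> i ik ui; split=> //; apply/existsP; exists i; rewrite ik.
Qed.

Lemma processed0 : processed 0 = set0.
Proof. by apply/setP => u; rewrite [RHS]inE; apply/negP => /processedP[_ []]. Qed.

Lemma processed_all : processed n = attached.
Proof.
apply/setP => u; apply/processedP/idP => [[]//|uH]; split=> //; exists u => //.
by rewrite mem_component (subsetP (attached_sub G S H)).
Qed.

Lemma processed_sub k : processed k \subset S.
Proof. by apply/subsetP => u /processedP[/(subsetP (attached_sub G S H))]. Qed.

Lemma processed_stale i : ~~ leader i -> processed i.+1 = processed i.
Proof.
move=> stale; apply/setP => u; apply/processedP/processedP => -[uH [k ki uk]]; split=> //.
  move: ki; rewrite ltnS leq_eqVlt => /orP[/eqP/val_inj ki|ki]; last by exists k.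
  move: stale; rewrite /leader -ki -(attached_component H uk) uH /= negbK.
  by case/existsP=> k' /andP[k'k kk']; exists k'; rewrite // -(component_eq kk').
by exists k; rewrite // ltnW.
Qed.

Lemma processed_leader i : leader i -> processed i.+1 = processed i :|: component i.
Proof.
case/andP=> iH _; apply/setP => u; rewrite in_setU.
apply/processedP/orP => [[uH [k ki uk]]|[/processedP[uH [k ki uk]]|ui]].
- move: ki; rewrite ltnS leq_eqVlt => /orP[/eqP/val_inj <-|ki]; first by right.
  by left; apply/processedP; split; last exists k.
- by split=> //; exists k; rewrite // ltnW.
- by split; [rewrite (attached_component H ui)|exists i].
Qed.

Lemma leader_disjoint i : leader i -> [disjoint processed i & component i].
Proof.
case/andP=> _ least; apply/pred0P => u /=; apply/negP.
case/andP=> /processedP[_ [k ki uk]] ui; case/existsP: least; exists k.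
by rewrite ki -(component_eq uk) component_sym.
Qed.

Lemma processed_edge k u z : u \in processed k -> G u z -> z \in S -> z \in processed k.
Proof.
move=> /processedP[uH [i ik ui]] uz zS; have zi := component_edge ui uz zS.
apply/processedP; split; last by exists i.
by rewrite (attached_component H zi) -(attached_component H ui).
Qed.

End Processed.

(** * Tree decompositions *)

Section RootedTree.
Variables (T : finType) (F : sgraph T) (r : T).
Hypothesis F_conn : forall s t : T, connect F s t.
Hypothesis F_acyclic : forall c : seq T, ucycle F c -> size c <= 2.
Implicit Types (S : {set T}) (s t a b : T).

(* The nodes that the removal of t separates from the root, and t itself. *)
Definition below t := ~: component F [set~ t] r.

Lemma below_refl t : t \in below t.
Proof.
rewrite in_setC; apply/negP => /(subsetP (component_sub _ _ _)).
by rewrite !inE eqxx.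
Qed.

Lemma below_trans t t' : t' \in below t -> below t' \subset below t.
Proof.
rewrite in_setC => t'r; rewrite setCS; case: (eqVneq r t) => [<-|rt].
  by apply/subsetP => s; rewrite inE !inE eqxx.
apply: connected_sub_component; first exact: component_connected.
  by apply/subsetP => s sr; rewrite !inE; apply: contraNneq t'r => <-.
by rewrite mem_component !inE.
Qed.

Lemma acyclic_neighbours t a b : F t a -> F t b -> b \in component F [set~ t] a -> a = b.
Proof.
move=> ta tb; rewrite inE => /andP[_ /connectP[p path_p eb]].
case/shortenP: path_p eb => -[//|y p'] path_p uniq_p _ eb.
suff /F_acyclic : ucycle F [:: t, a, y & p'] by [].
have t_notin : t \notin a :: y :: p'.
  have avoid_t x q : path (within F [set~ t]) x q -> t \notin q.
    elim: q x => //= z q IH x /andP[/and3P[_ zt _] /IH].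
    rewrite inE negb_or => ->; rewrite andbT.
    by apply: contraTneq zt => <-; rewrite !inE eqxx.
  rewrite inE negb_or (avoid_t _ _ path_p) andbT.
  by apply: contraTneq ta => <-; rewrite adj_irrefl.
apply/andP; split; last by rewrite cons_uniq t_notin.
rewrite /cycle rcons_path -[last _ _]/(last a (y :: p')) -eb adj_sym tb andbT.
rewrite -[path _ _ _]/(F t a && path F a (y :: p')) ta.
by apply: sub_path path_p => x z /and3P[].
Qed.

Lemma first_entry S : S != set0 -> exists2 t, t \in S &
  r = t \/ exists2 b, b \in component F (~: S) r & F b t.
Proof.
case/set0Pn=> s sS; case rS : (r \in S); first by exists r; last left.
have rC : r \in component F (~: S) r by rewrite mem_component inE rS.
suff [t /boundaryP[tC [b bC bt]]] : exists t, t \in boundary F (component F (~: S) r).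
  exists t; last by right; exists b.
  by apply: contraR tC => tS; apply: (component_edge bC bt); rewrite inE.
apply/set0Pn; apply: contraL sS => /eqP no_boundary.
suff /subsetP/(_ s) : component F setT r \subset component F (~: S) r.
  have -> : s \in component F setT r.
    rewrite inE in_setT; apply: connect_sub (F_conn r s) => a b ab.
    by apply: connect1; rewrite /within /= !in_setT.
  by move/(_ isT)/(subsetP (component_sub _ _ _)); rewrite inE.
apply: component_subset rC _ => a b aC _ ab; apply: contraT => bC.
by have := mem_boundary aC ab bC; rewrite no_boundary inE.
Qed.

Lemma below_antisym t t' : t \in below t' -> t' \in below t -> t = t'.
Proof.
move=> tt' t't; apply/eqP; apply: contraT => neq.
have first_not_below x y : x != y -> x \in below y ->
    ~ (r = x \/ exists2 b, b \in component F (~: [set x; y]) r & F b x).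
  move=> xy; rewrite in_setC => /negP xr [rx|[b br bx]]; apply: xr.
    by rewrite rx mem_component !inE.
  apply: (component_edge (u := b)) bx _; last by rewrite !inE.
  have sub : ~: [set x; y] \subset [set~ y] by rewrite setCS subsetUr.
  by move: br; rewrite !inE negb_or => /andP[/andP[_ ->]]; apply: connect_withinW.
have [|x /set2P[] ->] := @first_entry [set t; t'].
- by apply/set0Pn; exists t; rewrite set21.
- by move=> entry; case: (first_not_below t t').
by rewrite setUC => entry; case: (first_not_below t' t) => //; rewrite eq_sym.
Qed.

Lemma connected_set_top S : S != set0 -> connected_set F S ->
  exists2 t, t \in S & S \subset below t.
Proof.
move=> /first_entry[t tS entry] S_conn; exists t => //; apply/subsetP => s sS.
rewrite in_setC; apply/negP => sr.
have [rt st] : r != t /\ s != t.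
  have st := subsetP (component_sub _ _ _) s sr.
  by move: sr st; rewrite !inE => /andP[].
case: entry => [/eqP|[b br bt]]; first by rewrite (negPf rt).
have /boundaryP[_ [a sa at_]] := mem_boundary_component S_conn sS tS st.
have aS : a \in S by have := subsetP (component_sub _ _ _) a sa; rewrite inE => /andP[].
have ar : a \in component F [set~ t] r.
  rewrite -(component_eq sr); apply: (subsetP (component_mono _ _ _) a sa).
  by rewrite setDE subsetIr.
have br' : b \in component F [set~ t] r.
  by apply: (subsetP (component_mono _ _ _) b br); rewrite setCS sub1set.
have ab : a = b.
  by apply: (acyclic_neighbours (t := t)); rewrite ?(component_eq ar) // adj_sym.
by have := subsetP (component_sub _ _ _) b br; rewrite -ab inE aS.
Qed.

Lemma connected_set_below S t s : connected_set F S -> t \notin S -> s \in S ->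
  s \in below t -> S \subset below t.
Proof.
move=> S_conn tS sS; rewrite in_setC => sr; apply/subsetP => s' s'S.
rewrite in_setC; apply: contra sr => s'r; rewrite -(component_eq s'r).
apply: (subsetP (connected_sub_component S_conn _ s'S) s sS).
by apply/subsetP => x xS; rewrite !inE; apply: contraNneq tS => <-.
Qed.

Lemma below_proper t t' : t' \in below t -> t' != t -> below t' \proper below t.
Proof.
move=> t't neq; rewrite properE below_trans //=; apply: contraNN neq => /subsetP sub.
by rewrite (below_antisym t't (sub t (below_refl t))).
Qed.

End RootedTree.

Lemma connected_set_bigcup (V T : finType) (G : sgraph V) (F : sgraph T)
    (S : V -> {set T}) (D : {set V}) :
  connected_set G D -> (forall v, connected_set F (S v)) ->
  (forall u v, G u v -> exists t, (t \in S u) && (t \in S v)) ->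
  connected_set F (\bigcup_(v in D) S v).
Proof.
move=> D_conn S_conn S_meet x y /bigcupP[d dD xd] /bigcupP[e eD ye].
have step v s t : v \in D -> s \in S v -> t \in S v ->
    connect (within F (\bigcup_(v in D) S v)) s t.
  move=> vD sv tv; apply: connect_withinW (S_conn v s t sv tv).
  exact: bigcup_sup.
case/connectP: (D_conn d e dD eD) => p path_p ep.
elim: p d dD x xd path_p ep => [|v p IH] d dD x xd /=.
  by move=> _ ed; rewrite ed in ye; apply: (step d).
case/andP=> /and3P[_ vD dv] path_p ep; have [t /andP[td tv]] := S_meet d v dv.
exact: connect_trans (step d x t dD xd td) (IH v vD t tv path_p ep).
Qed.

Section EliminationKey.
Variables (V T : finType) (G : sgraph V) (F : sgraph T) (bag : T -> {set V}).
Hypothesis dec : tree_decomposition G F bag.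

Definition nodes v := [set t | v \in bag t].

Lemma nodes_neq0 v : nodes v != set0.
Proof. by case: dec => _ /(_ v)[t vt] _ _; apply/set0Pn; exists t; rewrite inE. Qed.

Lemma nodes_connected v : connected_set F (nodes v).
Proof.
case: dec => _ _ _ bag_conn x y; rewrite !inE => vx vy.
apply: connect_sub (bag_conn v x y vx vy) => a b /and3P[ab va vb].
by apply: connect1; rewrite /within /= !inE va vb.
Qed.

Lemma nodes_meet u v : G u v -> exists t, (t \in nodes u) && (t \in nodes v).
Proof. by case: dec => _ _ bag_edge _ /bag_edge[t uvt]; exists t; rewrite !inE. Qed.

Variable r : T.
Local Notation below := (below F r).

Lemma boundary_in_bag (D : {set V}) (top : V -> T) (u : V) :
  connected_set G D ->
  (forall v, top v \in nodes v) ->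
  u \in D -> \bigcup_(v in D) nodes v \subset below (top u) ->
  {in boundary G D, forall z, #|below (top u)| <= #|below (top z)|} ->
  boundary G D \subset bag (top u) :\ u.
Proof.
case: dec => [[_ F_conn F_acyclic] _ _ _] D_conn top_in uD D_below heavy.
apply/subsetP => z zD; have /boundaryP[z_notin [d dD dz]] := zD.
rewrite !inE; apply/andP; split; first by apply: contraNneq z_notin => ->.
apply: contraT => zt; have [s /andP[sd sz]] := nodes_meet dz.
have s_below : s \in below (top u).
  by apply: (subsetP D_below); apply/bigcupP; exists d.
have /subsetP z_below : nodes z \subset below (top u).
  by apply: connected_set_below (@nodes_connected z) _ sz s_below; rewrite inE.
have top_neq : top z != top u.
  by apply: contraNneq zt => <-; have := top_in z; rewrite inE.
have := below_proper F_conn (z_below _ (top_in z)) top_neq.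
by move/proper_card; rewrite ltnNge heavy.
Qed.

End EliminationKey.

(* A vertex weighs as much as the subtree below the topmost node containing it. *)
Lemma elimination_key_of_decomposition (V T : finType) (G : sgraph V) (F : sgraph T)
    (bag : T -> {set V}) (w : nat) :
  tree_decomposition G F bag -> (forall t, #|bag t| <= w.+1) ->
  exists key, elimination_key G w key.
Proof.
move=> dec bag_size; have [[T_gt0 F_conn F_acyclic] _ _ _] := dec.
have [r _] : exists r : T, r \in T by apply/card_gt0P.
have top_exists (S : {set T}) : S != set0 -> connected_set F S ->
    exists t, (t \in S) && (S \subset below F r t).
  by move=> S0 /(connected_set_top r F_conn F_acyclic S0)[t tS St]; exists t; rewrite tS.
have [top topP] := fin_all_exists (fun v =>
  top_exists _ (nodes_neq0 dec v) (@nodes_connected _ _ _ _ _ dec v)).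
have top_in v : top v \in nodes bag v by case/andP: (topP v).
exists (fun v => #|below F r (top v)|) => D D_neq0 D_conn D_dom.
have [||t /andP[/bigcupP[u uD ut] D_below]] := top_exists (\bigcup_(v in D) nodes bag v).
- have /set0Pn[d dD] := D_neq0; have /set0Pn[t td] := nodes_neq0 dec d.
  by apply/set0Pn; exists t; apply/bigcupP; exists d.
- apply: connected_set_bigcup D_conn _ (nodes_meet dec).
  exact: nodes_connected dec.
have top_u : top u = t.
  apply: (below_antisym (r := r) F_conn).
    by apply: (subsetP D_below); apply/bigcupP; exists u.
  by case/andP: (topP u) => _ /subsetP; apply.
rewrite -top_u in D_below ut.
have heavy : {in boundary G D, forall z, #|below F r (top u)| <= #|below F r (top z)|}.
  by move=> z zD; apply: D_dom.
have /subset_leq_card := boundary_in_bag dec D_conn top_in uD D_below heavy.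
move/leq_trans; apply; have := bag_size (top u).
by rewrite inE in ut; rewrite (cardsD1 u) ut add1n ltnS.
Qed.

(** * Labellings and isometric path partitions *)

Definition walk (V : finType) (e : rel V) (s : nat) (x v : V) : Prop :=
  exists p, [/\ path e x p, last x p = v & size p <= s].

Section Walks.
Variables (V : finType) (e : rel V).
Implicit Types (x u v : V).

Lemma walk0 x : walk e 0 x x. Proof. by exists [::]. Qed.

Lemma walkW s s' x v : s <= s' -> walk e s x v -> walk e s' x v.
Proof.
by move=> le_s [p [path_p lastp size_p]]; exists p; split=> //; apply: leq_trans le_s.
Qed.

Lemma walkS s x u v : walk e s x u -> e u v -> walk e s.+1 x v.
Proof.
move=> [p [path_p lastp size_p]] uv; exists (rcons p v).
by rewrite rcons_path last_rcons size_rcons path_p lastp.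
Qed.

Lemma walkS_inv s x v :
  walk e s.+1 x v -> walk e s x v \/ exists2 u, walk e s x u & e u v.
Proof.
move=> [p]; case/lastP: p => [|p y] []; first by move=> _ <- _; left; exists [::].
rewrite rcons_path last_rcons size_rcons => /andP[path_p py] <- size_p.
by right; exists (last x p); first exists p.
Qed.

Lemma connect_walk x v : walk e #|V| x v <-> connect e x v.
Proof.
split=> [[p [path_p <- _]]|/connectP[p path_p ->]]; first by apply/connectP; exists p.
case/shortenP: path_p => q path_q /card_uniqP uniq_q _; exists q; split=> //.
by have := max_card (mem (x :: q)); rewrite uniq_q => /ltnW.
Qed.

End Walks.

Lemma eq_walk (V : finType) (e e' : rel V) s x v :
  e =2 e' -> walk e s x v <-> walk e' s x v.
Proof.
move=> ee'; split=> -[p [path_p last_p size_p]]; exists p; split=> //.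
  by rewrite -(eq_path ee').
by rewrite (eq_path ee').
Qed.

Section IsometricWalks.
Variables (V : finType) (G : sgraph V).
Implicit Types (x u v : V) (p q : seq V).
Local Notation walk := (walk G).

Lemma walk_path s x v : walk s x v ->
  exists p, [/\ is_path G x p, last x p = v & size p <= s].
Proof.
move=> [p [path_p <- size_p]]; case/shortenP: path_p => q path_q uniq_q sub.
exists q; split=> //; apply: leq_trans size_p; apply: uniq_leq_size sub.
by case/andP: uniq_q.
Qed.

Lemma path_size x p : is_path G x p -> size p < #|V|.
Proof.
by case=> _ /card_uniqP uniq_p; have := max_card (mem (x :: p)); rewrite uniq_p.
Qed.

Lemma last_take_nth x p i : i <= size p -> last x (take i p) = nth x (x :: p) i.
Proof.
elim: p x i => [|y p IH] x [|i] //= i_le; rewrite IH //.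
by apply: set_nth_default; rewrite /= ltnS.
Qed.

Lemma walk_take x p i : path G x p -> i <= size p -> walk i x (nth x (x :: p) i).
Proof.
move=> path_p i_le; exists (take i p); split; last by rewrite size_takel.
  by move: path_p; rewrite -{1}(cat_take_drop i p) cat_path => /andP[].
exact: last_take_nth.
Qed.

Lemma isometric_index_le x p v t : isometric_path G x p -> v \in x :: p ->
  walk t x v -> index v (x :: p) <= t.
Proof.
move=> [[path_p _] shortest] v_in [q [path_q last_q size_q]]; apply: leq_trans size_q.
have := nth_index x v_in; have : index v (x :: p) < size (x :: p) by rewrite index_mem.
move: (index v (x :: p)) => i; rewrite ltnS => i_le nth_i.
have last_i : last x (take i p) = v by rewrite last_take_nth.
have [path_drop last_drop] : path G v (drop i p) /\ last v (drop i p) = last x p.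
  split; last by rewrite -{2}(cat_take_drop i p) last_cat last_i.
  by move: path_p; rewrite -{1}(cat_take_drop i p) cat_path last_i => /andP[].
have /walk_path[q' [path_q' last_q' size_q']] : walk (size q + (size p - i)) x (last x p).
  exists (q ++ drop i p).
  by rewrite cat_path last_cat last_q path_q path_drop last_drop size_cat size_drop.
rewrite -(leq_add2r (size p - i)) subnKC //.
exact: leq_trans (shortest _ path_q' last_q') size_q'.
Qed.

(* The vertex v lies on the path that starts at start v, between prv v and nxt v,
   which are v itself at the ends of the path. *)
Record path_labels (start prv nxt : V -> V) : Prop := PathLabels {
  label_start : forall v, prv v = v -> start v = v;
  label_prv : forall v, prv v != v -> G (prv v) v;
  label_closer : forall v, prv v != v ->
    exists s, [/\ s < #|V|, walk s (start v) (prv v) & ~ walk s (start v) v];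
  label_nxt : forall v, nxt v != v -> G v (nxt v);
  label_prvK : forall v, prv v != v -> start (prv v) = start v /\ nxt (prv v) = v;
  label_nxtK : forall v, nxt v != v -> start (nxt v) = start v /\ prv (nxt v) = v }.

End IsometricWalks.

Section PartitionOfLabels.
Variables (V : finType) (G : sgraph V) (start prv nxt : V -> V).
Hypothesis labels : path_labels G start prv nxt.
Implicit Types u v x : V.
Local Notation walk := (walk G).

Lemma trace_from_start v :
  prv (start v) = start v /\ exists j, v = iter j nxt (start v).
Proof.
suff trace s u : walk s (start u) u ->
    prv (start u) = start u /\ exists j, u = iter j nxt (start u).
  case: (eqVneq (prv v) v) => [prv_v|moved].
    by apply: (@trace 0); rewrite (label_start labels prv_v); apply: walk0.
  have [s [_ walk_prv _]] := label_closer labels moved.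
  exact: trace s.+1 v (walkS walk_prv (label_prv labels moved)).
elim: s u => [|s IH] u walk_u; case: (eqVneq (prv u) u) => [prv_u|moved];
  try by rewrite (label_start labels prv_u); split=> //; exists 0.
  by have [s' [_ _ []]] := label_closer labels moved; apply: walkW walk_u.
have [s' [_ walk_prv no_walk]] := label_closer labels moved.
have [start_prv nxt_prv] := label_prvK labels moved.
have s's : s' <= s by rewrite leqNgt; apply/negP => ss'; apply/no_walk/(walkW ss').
have [] := IH (prv u); first by rewrite start_prv; apply: walkW walk_prv.
by rewrite start_prv => prv_start [j uj]; split=> //; exists j.+1; rewrite iterS -uj.
Qed.

Section Block.
Variable x : V.
Hypothesis prv_x : prv x = x.
Local Notation it i := (iter i nxt x).

Lemma trace_dist j : (forall i, i < j -> nxt (it i) != it i) ->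
  [/\ start (it j) = x, walk j x (it j) & forall t, walk t x (it j) -> j <= t].
Proof.
elim: j => [|j IH] moving.
  by split=> //; [exact: label_start labels _ prv_x|exact: walk0].
have [|start_j walk_j dist_j] := IH; first by move=> i ij; apply/moving/leqW.
have moved := moving j (ltnSn j); have [start_nxt prv_nxt] := label_nxtK labels moved.
split=> [||t walk_t]; rewrite ?iterS.
- by rewrite start_nxt.
- exact: walkS walk_j (label_nxt labels moved).
have moved' : prv (nxt (it j)) != nxt (it j) by rewrite prv_nxt eq_sym.
have [s [_ walk_s no_walk]] := label_closer labels moved'.
rewrite start_nxt start_j prv_nxt in walk_s no_walk.
rewrite ltnNge; apply/negP => tj; apply/no_walk/(walkW _ walk_t).
exact: leq_trans tj (dist_j s walk_s).
Qed.

Lemma trace_stops : exists2 r, nxt (it r) = it r & forall i, i < r -> nxt (it i) != it i.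
Proof.
have stops : exists r, nxt (it r) == it r.
  case: (pickP (fun r : 'I_#|V|.+1 => nxt (it r) == it r)) => [r stop|moving].
    by exists r.
  have [|_ walk_n dist_n] := @trace_dist #|V|.
    by move=> i i_lt; have := moving (inord i); rewrite inordK ?leqW // => ->.
  have [p [path_p last_p _]] := walk_path walk_n.
  suff /dist_n : walk (size p) x (it #|V|) by rewrite leqNgt (path_size path_p).
  by exists p; case: path_p.
case: (ex_minnP stops) => r /eqP stop least; exists r => // i ir.
by apply: contraL ir => /least; rewrite -leqNgt.
Qed.

Lemma trace_isometric r : (forall i, i < r -> nxt (it i) != it i) ->
  isometric_path G x (traject nxt (nxt x) r).
Proof.
move=> moving; have [_ _ dist_r] := trace_dist moving.
have moving_below i : i <= r -> forall k, k < i -> nxt (it k) != it k.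
  by move=> ir k ki; apply/moving/(leq_trans ki).
split; last by move=> q [path_q _]; rewrite last_traject size_traject => last_q;
  apply: dist_r; exists q.
have traceE : x :: traject nxt (nxt x) r = traject nxt x r.+1 by [].
split; last first.
  rewrite traceE looping_uniq; apply/trajectP => -[i ir loop].
  have [_ walk_i _] := trace_dist (moving_below i (ltnW ir)).
  by rewrite -loop in walk_i; have := dist_r _ walk_i; rewrite leqNgt ir.
apply/(pathP x) => i; rewrite size_traject => ir.
rewrite traceE (nth_traject _ (leqW ir)) (set_nth_default (nxt x)) ?size_traject //.
by rewrite (nth_traject _ ir) -iterSr; apply/(label_nxt labels)/moving.
Qed.

Lemma isometric_block : exists p,
  isometric_path G x p /\ [set v | start v == x] = [set v in x :: p].
Proof.
have [r stop moving] := trace_stops; exists (traject nxt (nxt x) r).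
split; first exact: trace_isometric.
apply/setP => v; rewrite !inE -in_cons -[_ :: _]/(traject nxt x r.+1).
apply/eqP/trajectP => [start_v|[i ir ->]]; last first.
  by have [] := @trace_dist i (fun k ki => moving k (leq_trans ki ir)).
have [_ [j]] := trace_from_start v; rewrite start_v => ->.
case: (leqP j r) => [jr|/ltnW rj]; first by exists j.
exists r => //; rewrite -(subnK rj) iterD.
by elim: (j - r) => // k IH; rewrite iterS IH stop.
Qed.

End Block.

Lemma partition_of_labels : isometric_path_partition G #|[set v | prv v == v]|.
Proof.
pose B x := [set v | start v == x].
have mem_block x : prv x = x -> x \in B x.
  by move=> /(label_start labels); rewrite inE => ->.
exists [set B x | x in [set v | prv v == v]]; split.
- apply/and3P; split.
  + apply/eqP/setP => v; rewrite in_setT; apply/bigcupP; exists (B (start v)).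
      by apply: imset_f; rewrite inE; have [-> _] := trace_from_start v.
    by rewrite inE.
  + apply/trivIsetP => _ _ /imsetP[x _ ->] /imsetP[y _ ->]; apply: contraNT.
    case/pred0Pn=> v /andP[]; rewrite !inE => /eqP start_v.
    by rewrite start_v => /eqP->.
  + apply/imsetP => -[x]; rewrite inE => /eqP/mem_block + B0.
    by rewrite -B0 inE.
- apply: card_in_imset => x y; rewrite !inE => /eqP prv_x _ Bxy.
  by have := mem_block x prv_x; rewrite Bxy inE (label_start labels prv_x) => /eqP.
- by move=> _ /imsetP[x + ->]; rewrite inE => /eqP/isometric_block[p]; exists x, p.
Qed.

End PartitionOfLabels.

Section LabelsOfPathCover.
Variables (V : finType) (G : sgraph V) (W : V -> seq V).
Hypothesis mem_W : forall v, v \in W v.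
Hypothesis eq_W : forall u v, u \in W v -> W u = W v.
Hypothesis isometric_W : forall v, exists x p, W v = x :: p /\ isometric_path G x p.
Implicit Types u v : V.

Definition position v := index v (W v).
Definition cover_start v := head v (W v).
Definition cover_prv v := nth v (W v) (position v).-1.
Definition cover_nxt v := nth v (W v) (position v).+1.

Lemma uniq_W v : uniq (W v).
Proof. by have [x [p [-> [[]]]]] := isometric_W v. Qed.

Lemma position_lt v : position v < size (W v). Proof. by rewrite index_mem. Qed.

Lemma nth_position v d : nth d (W v) (position v) = v.
Proof. by rewrite nth_index. Qed.

Lemma position_nth v d j : j < size (W v) -> position (nth d (W v) j) = j.
Proof. by move=> j_lt; rewrite /position (@eq_W _ v) ?mem_nth // index_uniq ?uniq_W. Qed.

Lemma adj_nth v d j : j.+1 < size (W v) -> G (nth d (W v) j) (nth d (W v) j.+1).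
Proof. by have [x [p [-> [[/(pathP d)]]]]] := isometric_W v => adj _ _; apply: adj. Qed.

Lemma cover_prv_fixed v : (cover_prv v == v) = (position v == 0).
Proof.
have pred_lt := leq_ltn_trans (leq_pred _) (position_lt v).
rewrite -{2}(nth_position v v) nth_uniq ?uniq_W ?position_lt //.
by case: (position v) => // j; rewrite ltn_eqF.
Qed.

Lemma cover_start_nth v d j : j < size (W v) ->
  cover_start (nth d (W v) j) = cover_start v.
Proof.
move=> j_lt; rewrite /cover_start (@eq_W _ v) ?mem_nth //.
by case: (W v) (mem_W v).
Qed.

Lemma cover_prvK v j : position v = j.+1 -> cover_nxt (cover_prv v) = v.
Proof.
move=> pos_v; have j_lt : j < size (W v) by apply: ltnW; rewrite -pos_v position_lt.
rewrite /cover_nxt /cover_prv pos_v /= (@eq_W _ v) ?mem_nth // position_nth //.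
by rewrite -pos_v nth_position.
Qed.

Lemma cover_closer v j : position v = j.+1 ->
  walk G j (cover_start v) (cover_prv v) /\ ~ walk G j (cover_start v) v.
Proof.
move=> pos_v; have v_lt := position_lt v; rewrite pos_v in v_lt.
have [x [p [Wv iso]]] := isometric_W v; rewrite /cover_start /cover_prv pos_v Wv /=.
split=> [|walk_v]; last first.
  have := isometric_index_le iso _ walk_v.
  by rewrite -Wv -/(position v) pos_v ltnn => /(_ (mem_W v)).
rewrite (set_nth_default x) -?Wv 1?ltnW // Wv.
by apply: walk_take; [case: iso => -[] | rewrite Wv in v_lt; apply: ltnW].
Qed.

Lemma labels_of_path_cover : path_labels G cover_start cover_prv cover_nxt.
Proof.
have position_pos v : cover_prv v != v -> exists j, position v = j.+1.
  by rewrite cover_prv_fixed; case: (position v) => // j; exists j.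
have nxt_lt v : cover_nxt v != v -> (position v).+1 < size (W v).
  by rewrite ltnNge; apply: contraNN => /(nth_default v) nxt_v; rewrite /cover_nxt nxt_v.
split=> v => [/eqP|/position_pos[j pos_v]|/position_pos[j pos_v]|/nxt_lt lt|
  /position_pos[j pos_v]|/nxt_lt lt].
- rewrite cover_prv_fixed => /eqP pos_v; rewrite -{2}(nth_position v v) pos_v.
  by rewrite /cover_start; case: (W v).
- have v_lt := position_lt v; rewrite pos_v in v_lt; have := adj_nth v v_lt.
  by rewrite /cover_prv pos_v /= -pos_v nth_position.
- have [walk_prv no_walk] := cover_closer pos_v; exists j; split=> //.
  have v_lt := position_lt v; rewrite pos_v in v_lt.
  by rewrite (leq_trans (ltnW v_lt)) // -(card_uniqP (uniq_W v)) max_card.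
- by rewrite -{1}(nth_position v v); apply: adj_nth.
- split; last exact: cover_prvK pos_v.
  by rewrite cover_start_nth // (leq_ltn_trans (leq_pred _)) ?position_lt.
- split; first exact: cover_start_nth.
  by rewrite /cover_prv (@eq_W _ v) ?mem_nth // position_nth //= nth_position.
Qed.

End LabelsOfPathCover.

Lemma labels_of_partition (V : finType) (G : sgraph V) k : isometric_path_partition G k ->
  exists start prv nxt, path_labels G start prv nxt /\ #|[set v | prv v == v]| = k.
Proof.
move=> [P [partP <- isoP]]; have [/eqP cover_P triv_P P_neq0] := and3P partP.
have trace (S : {set V}) : exists w : seq V, S \in P ->
    exists x p, [/\ w = x :: p, isometric_path G x p & S = [set v in w]].
  case SP : (S \in P); last by exists [::].
  by have [x [p [iso Sp]]] := isoP S SP; exists (x :: p) => _; exists x, p.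
have [w wP] := fin_all_exists trace.
have block_in v : pblock P v \in P by apply: pblock_mem; rewrite cover_P inE.
pose W v := w (pblock P v).
have memW u v : (u \in W v) = (u \in pblock P v).
  by have [x [p [_ _ e]]] := wP _ (block_in v); rewrite [in RHS]e inE.
have mem_W v : v \in W v by rewrite memW mem_pblock cover_P inE.
have eq_W u v : u \in W v -> W u = W v.
  by rewrite memW /W => /(def_pblock triv_P (block_in v))->.
have iso_W v : exists x p, W v = x :: p /\ isometric_path G x p.
  by have [x [p [e iso _]]] := wP _ (block_in v); exists x, p.
have labels := labels_of_path_cover mem_W eq_W iso_W.
exists (cover_start W), (cover_prv W), (cover_nxt W); split=> //.
have <- : [set pblock P v | v in [set v | cover_prv W v == v]] = P.
  apply/setP => S; apply/imsetP/idP => [[v _ ->]|SP]; first exact: block_in.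
  have [x [p [wE iso SE]]] := wP S SP; have xS : x \in S by rewrite SE wE inE mem_head.
  have blockE : pblock P x = S by apply: def_pblock.
  exists x; rewrite // inE (cover_prv_fixed mem_W iso_W) /position /W blockE wE.
  by rewrite /= eqxx.
rewrite card_in_imset // => u v; rewrite !inE !(cover_prv_fixed mem_W iso_W).
move=> /eqP pos_u /eqP pos_v eq_block; have Wuv : W u = W v by rewrite /W eq_block.
by rewrite -(nth_position mem_W u u) -(nth_position mem_W v u) pos_u pos_v Wuv.
Qed.

Lemma partition_card (V : finType) (G : sgraph V) k :
  isometric_path_partition G k -> k <= #|V|.
Proof.
move=> [P [partP <- _]]; have /and3P[_ _ P_neq0] := partP.
rewrite -cardsT (card_partition partP) -sum1_card; apply: leq_sum => S SP.
by rewrite card_gt0; apply: contraNneq P_neq0 => <-.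
Qed.

Lemma trivial_partition (V : finType) (G : sgraph V) : isometric_path_partition G #|V|.
Proof.
have -> : #|V| = #|[set v : V | v == v]|.
  by rewrite -cardsT; apply: eq_card => v; rewrite !inE eqxx.
by apply: (@partition_of_labels _ _ id id id); split=> // v; rewrite eqxx.
Qed.

Lemma edgeless_partition (V : finType) (G : sgraph V) k : (forall u v, G u v = false) ->
  isometric_path_partition G k <-> k = #|V|.
Proof.
move=> no_edge; split=> [[P [partP <- isoP]]|->]; last exact: trivial_partition.
rewrite -cardsT (card_partition partP) -sum1_card.
apply: eq_bigr => S /isoP[x [[|y p] [[[path_p _] _] ->]]]; last first.
  by move: path_p; rewrite /= no_edge.
by apply/esym/eqP/cards1P; exists x; apply/setP => y; rewrite !inE.
Qed.

(** * Constraint satisfaction on a graph *)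

Section Constraints.
Variables (V : finType) (G : sgraph V) (L : Type).
Variables (ok : V -> L -> bool) (compat : L -> L -> bool).
Hypothesis compat_sym : forall a b, compat a b = compat b a.
Implicit Types (lam : V -> L) (A C : {set V}).

Definition valid_on lam A : Prop := forall u, u \in A ->
  ok u (lam u) /\ forall z, G u z -> compat (lam u) (lam z).

Lemma valid_on_U1 lam u A : valid_on lam A -> ok u (lam u) ->
  (forall z, G u z -> z \notin A -> compat (lam u) (lam z)) -> valid_on lam (u |: A).
Proof.
move=> valid_A ok_u compat_u x /setU1P[->|/valid_A//]; split=> // z uz.
case: (boolP (z \in A)) => [/valid_A[_ compat_z]|]; last exact: compat_u.
by rewrite compat_sym compat_z // adj_sym.
Qed.

Lemma valid_on_glue lam lam' A C : valid_on lam A -> valid_on lam' C ->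
  [disjoint A & C] -> (forall u z, u \in A -> G u z -> z \notin C) ->
  {in boundary G C, lam =1 lam'} ->
  valid_on (fun v => if v \in C then lam' v else lam v) (A :|: C).
Proof.
move=> valid_A valid_C dAC far agree u /setUP[uA|uC].
  have [ok_u compat_u] := valid_A u uA; rewrite (disjointFr dAC uA).
  by split=> // z uz; rewrite (negPf (far u z uA uz)); apply: compat_u.
have [ok_u compat_u] := valid_C u uC; rewrite uC; split=> // z uz.
case: ifPn => zC; first exact: compat_u.
by rewrite agree ?compat_u //; apply: mem_boundary uC uz zC.
Qed.

End Constraints.

(** * Soundness of the dynamic program *)

Record represents (n : nat) (g : rel nat) (G : sgraph 'I_n) : Prop := Represents {
  represents_lt : forall u v, g u v -> (u < n) && (v < n);
  representsE : forall u v : 'I_n, g u v = G u v }.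

Section Correctness.
Variables (n m : nat) (g : rel nat) (G : sgraph 'I_n).
Hypothesis gG : represents g G.
Local Notation V := 'I_n.
Local Notation R := (ranged_reach n m g).
Local Notation N := (bag_bound n m).
Implicit Types (Z Y : nat) (u v i : V).

Definition rest Z : {set V} := [set u : V | ~~ in_bag n m Z u].
Definition near Z : pred V := fun u => near_head n g Z u.
Local Notation component Z := (component G (rest Z)).
Local Notation processed Z := (processed G (rest Z) (near Z)).

Lemma represents_sym : symmetric g.
Proof.
suff sym (u v : nat) : g u v -> g v u by move=> u v; apply/idP/idP; apply: sym.
move=> uv; have /andP[u_lt v_lt] := represents_lt gG uv.
have := representsE gG (Ordinal v_lt) (Ordinal u_lt) => /= ->.
by rewrite adj_sym -(representsE gG (Ordinal u_lt) (Ordinal v_lt)).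
Qed.

Lemma in_bagP Z (u : nat) :
  reflect (exists2 j, j <= m & bag_vertex n Z j = u) (in_bag n m Z u).
Proof.
apply: (iffP existsP) => [[j /eqP Zj]|[j jm Zj]]; first by exists j; rewrite // -ltnS.
by exists (inord j); rewrite inordK // Zj.
Qed.

Lemma in_tailP Z (u : nat) :
  reflect (exists2 j, j < m & bag_vertex n Z j.+1 = u) (in_tail n m Z u).
Proof.
apply: (iffP existsP) => [[j /eqP Zj]|[j jm Zj]]; first by exists j.
by exists (Ordinal jm); rewrite /= Zj.
Qed.

Lemma mem_bag Z j : j <= m -> in_bag n m Z (bag_vertex n Z j).
Proof.
by move=> jm; apply/existsP; exists (inord j); rewrite inordK.
Qed.

Lemma tail_in_bag Z (u : nat) : in_tail n m Z u -> in_bag n m Z u.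
Proof. by case/in_tailP=> j jm <-; apply: mem_bag. Qed.

Lemma in_bagE Z (u : nat) : in_bag n m Z u = (bag_vertex n Z 0 == u) || in_tail n m Z u.
Proof.
apply/existsP/orP => [[[[|j] jm] /= Zj]|[/eqP<-|/tail_in_bag/existsP//]].
- by left.
- by right; apply/in_tailP; exists j => //; apply/eqP.
- by exists ord0.
Qed.

Lemma bag_vertex_le Z j : bag_vertex n Z j <= n.
Proof. exact: code_vertex_le. Qed.

Lemma reach_in_range s (i u : nat) Z :
  reach n m g s i u Z -> [/\ i < n, u < n & ~~ in_bag n m Z u].
Proof.
elim: s u => [|s IH] u /=; first by case/and3P=> /eqP->.
case/orP=> [/IH//|/and3P[u_lt uZ /existsP[v /andP[/IH[i_lt _ _] _]]]].
by split.
Qed.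

Lemma reach_walk s i u Z : reach n m g s i u Z <->
  i \in rest Z /\ walk (within G (rest Z)) s i u.
Proof.
elim: s u => [|s IH] u /=; split.
- by case/and3P=> /eqP/val_inj<- _ iZ; rewrite inE; split=> //; apply: walk0.
- case=> + [p [_ <- /[!leqn0]/nilP-> /=]]; rewrite inE => iZ.
  by rewrite /reach_base eqxx ltn_ord.
- case/orP=> [/IH[iZ /(walkW (leqnSn s))] //|/and3P[_ uZ /existsP[v /andP[iv vu]]]].
  have [_ _ vZ] := reach_in_range iv; have [iZ walk_v] := (IH v).1 iv; split=> //.
  by apply: walkS walk_v _; rewrite /within /= !inE vZ uZ -(representsE gG).
case=> iZ /walkS_inv[walk_u|[v walk_v /and3P[vZ uZ vu]]]; apply/orP.
  by left; apply/IH.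
right; rewrite ltn_ord; rewrite inE in uZ; rewrite uZ; apply/existsP; exists v.
by rewrite (representsE gG) vu andbT; apply/IH.
Qed.

Lemma ranged_reachE s (i u : nat) Z : s <= n -> i <= n -> u <= n -> Z < N ->
  R s i u Z = reach n m g s i u Z.
Proof.
by move=> sn le_i le_u Z_lt; rewrite /ranged_reach /in_range Z_lt !ltn_bag_bound.
Qed.

Lemma reach_component i u Z : Z < N -> R n i u Z = (u \in component Z i).
Proof.
move=> Z_lt; rewrite (ranged_reachE (leqnn n) (ltnW (ltn_ord i)) (ltnW (ltn_ord u)) Z_lt).
apply/idP/idP => [/reach_walk[iZ walk_u]|]; rewrite inE.
  by rewrite iZ; apply/connect_walk; rewrite card_ord.
by move=> /andP[iZ /connect_walk]; rewrite card_ord => walk_u; apply/reach_walk.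
Qed.

Lemma touches_attached Z u : Z < N ->
  touches n g R Z u = (u \in attached G (rest Z) (near Z)).
Proof.
move=> Z_lt; apply/existsP/attachedP => [[y]|[y yu near_y]].
  by rewrite reach_component // => /andP[yu near_y]; exists y.
by exists y; rewrite reach_component // yu.
Qed.

Lemma fresh_leader Z i : Z < N ->
  fresh n g R Z i = leader G (rest Z) (near Z) i.
Proof.
move=> Z_lt; rewrite /fresh touches_attached //; congr (_ && ~~ _).
by apply: eq_existsb => i'; rewrite reach_component.
Qed.

(* Z' takes over the component of i: its head u lies in the component, and the
   tail separates the component from the rest of the graph. *)
Record split_at Z i Z' u : Prop := SplitAt {
  split_head : bag_vertex n Z' 0 = u;
  split_mem : u \in component Z i;
  split_tail : forall v : nat, in_tail n m Z' v -> in_bag n m Z v;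
  split_boundary : {in boundary G (component Z i), forall z : V, in_tail n m Z' z} }.

Lemma component_processed Z i Z' u : split_at Z i Z' u ->
  component Z i = u |: processed Z' n.
Proof.
case=> head_u uC tail boundary_tail; rewrite processed_all.
have -> : attached G (rest Z') (near Z') = attached G (rest Z') (G u).
  apply/setP => v; rewrite !inE; apply: eq_existsb => y.
  rewrite /near /near_head head_u (ltn_eqF (ltn_ord u)) represents_sym.
  by rewrite (representsE gG).
apply: component_split uC _ _ _ => [||z /boundary_tail]; rewrite ?inE ?negbK.
- by rewrite in_bagE head_u eqxx.
- apply/subsetP => v; rewrite !inE [in_bag n m Z' v]in_bagE head_u; apply: contraR.
  by rewrite negb_or negbK val_eqE eq_sym => /andP[/negPf-> /tail].
- exact: tail_in_bag.
Qed.

Lemma split_head_notin Z i Z' u k : split_at Z i Z' u -> u \notin processed Z' k.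
Proof.
case=> head_u _ _ _; apply/negP => /(subsetP (processed_sub _ _ _ _)).
by rewrite inE in_bagE head_u eqxx.
Qed.

Lemma link_split Z i Z' : Z < N -> link n m g R Z i Z' -> exists u, split_at Z i Z' u.
Proof.
move=> Z_lt /and5P[head_reach _ _ /forallP tail_codes /forallP boundary_tail].
have head_lt : bag_vertex n Z' 0 < n.
  by move: head_reach => /andP[_ /reach_in_range[]].
exists (Ordinal head_lt); split=> //.
- by rewrite -reach_component.
- move=> v /in_tailP[j jm <-]; have /existsP[j' /eqP code_j] := tail_codes (Ordinal jm).
  by rewrite /bag_vertex code_j mem_bag // -ltnS.
move=> z /boundaryP[zC [x xC xz]].
have := boundary_tail x; rewrite reach_component // xC => /forallP/(_ z).
by rewrite (representsE gG) xz reach_component // (negPf zC).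
Qed.

Definition vertex_ok u q := (code_vertex n q == u) && admissible n m g R q.

Local Notation valid := (valid_on G vertex_ok (mutually_compatible n)).
Implicit Types (lam : V -> nat) (A : {set V}).

Definition starts lam A : nat := \sum_(v in A) is_start n (lam v).

Definition extends lam Z : Prop :=
  forall j v, j <= m -> bag_vertex n Z j = v -> lam v = bag_code n Z j.

Lemma mutually_compatible_sym q q' :
  mutually_compatible n q q' = mutually_compatible n q' q.
Proof. exact: andbC. Qed.

Lemma starts_le lam A : starts lam A <= n.
Proof.
apply: leq_trans (_ : \sum_(v in A) 1 <= _).
  by apply: leq_sum => v _; case: is_start.
by rewrite sum1_card -[leqRHS]card_ord max_card.
Qed.

Lemma startsU lam A A' : [disjoint A & A'] ->
  starts lam (A :|: A') = starts lam A + starts lam A'.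
Proof.
by move=> dAA'; rewrite /starts -bigU //; apply: eq_bigl => x; rewrite in_setU.
Qed.

Lemma starts_leader lam Z i Z' u : leader G (rest Z) (near Z) i -> split_at Z i Z' u ->
  starts lam (processed Z i.+1) =
    starts lam (processed Z i) + starts lam (processed Z' n) + is_start n (lam u).
Proof.
move=> lead_i S; rewrite processed_leader // startsU ?leader_disjoint //.
rewrite (component_processed S) {2}/starts big_setU1 ?(split_head_notin _ S) //=.
by rewrite addnA addnAC.
Qed.

Lemma consistent_extends Z : consistent n m Z -> exists lam, extends lam Z.
Proof.
move=> /forallP cons_Z; pose pos v := [pick j : 'I_m.+1 | bag_vertex n Z j == v].
exists (fun v => if pos v is Some j then bag_code n Z j else 0) => j v jm Zj.
rewrite /pos; case: pickP => [j' Zj'|/(_ (inord j))]; last by rewrite inordK // Zj eqxx.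
have /forallP/(_ (inord j)) := cons_Z j'.
by rewrite inordK // Zj Zj' => /eqP.
Qed.

Section Glue.
Variables (Z Z' : nat) (i u : V) (lam lam' : V -> nat).
Hypotheses (Z_lt : Z < N) (lead_i : leader G (rest Z) (near Z) i).
Hypotheses (linked : link n m g R Z i Z') (S : split_at Z i Z' u).
Hypotheses (ext_Z : extends lam Z) (ext_Z' : extends lam' Z').
Hypotheses (valid_Z : valid lam (processed Z i)) (valid_Z' : valid lam' (processed Z' n)).

Definition glue v := if v \in component Z i then lam' v else lam v.

Lemma glue_tail : {in boundary G (component Z i), lam =1 lam'}.
Proof.
move=> z /(split_boundary S)/in_tailP[j jm Z'j].
have /and5P[_ _ _ /forallP/(_ (Ordinal jm))/existsP[j' /eqP code_j] _] := linked.
rewrite (ext_Z' (j := j.+1) _ Z'j) // code_j; apply: ext_Z; first by rewrite -ltnS.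
by rewrite -Z'j /bag_vertex code_j.
Qed.

Lemma glue_old v : v \in processed Z i -> glue v = lam v.
Proof. by move=> vP; rewrite /glue (disjointFr (leader_disjoint lead_i) vP). Qed.

Lemma glue_extends : extends glue Z.
Proof.
move=> j v jm Zj; rewrite /glue ifN; first exact: ext_Z jm Zj.
apply/negP => /(subsetP (component_sub _ _ _)); rewrite inE => /negP; apply.
by rewrite -Zj mem_bag.
Qed.

Lemma glue_valid : valid glue (processed Z i.+1).
Proof.
rewrite processed_leader //.
apply: (valid_on_glue valid_Z) => [|||]; last exact: glue_tail.
- rewrite (component_processed S); have /and5P[_ adm compat_tail _ _] := linked.
  have lam'_u := ext_Z' (leq0n m) (split_head S).
  apply: valid_on_U1 valid_Z' _ _ => [//||z uz zP]; first exact: mutually_compatible_sym.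
    by rewrite /vertex_ok lam'_u -/(bag_vertex n Z' 0) (split_head S) eqxx.
  have /(split_boundary S)/in_tailP[j jm Z'j] : z \in boundary G (component Z i).
    apply: (mem_boundary (split_mem S) uz).
    rewrite (component_processed S) in_setU1 negb_or zP andbT.
    by apply: contraTneq uz => ->; rewrite adj_irrefl.
  rewrite lam'_u (ext_Z' (j := j.+1) _ Z'j) //.
  by have /forallP/(_ (Ordinal jm)) := compat_tail.
- exact: leader_disjoint.
move=> v z vP vz; apply/negP => zC; have zS := subsetP (component_sub _ _ _) z zC.
by have := processed_edge vP vz zS; rewrite (disjointFl (leader_disjoint lead_i) zC).
Qed.

Lemma glue_starts : starts glue (processed Z i.+1) =
  starts lam (processed Z i) + starts lam' (processed Z' n)
    + is_start n (bag_code n Z' 0).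
Proof.
have sub : processed Z' n \subset component Z i.
  by rewrite (component_processed S) subsetUr.
rewrite (starts_leader _ lead_i S); congr (_ + _ + is_start _ _).
- by apply: eq_bigr => v vP; rewrite glue_old.
- by apply: eq_bigr => v vP; rewrite /glue (subsetP sub).
by rewrite /glue (split_mem S) (ext_Z' (leq0n m) (split_head S)).
Qed.

End Glue.

Definition solves lam Z (k : nat) c : Prop :=
  [/\ extends lam Z, valid lam (processed Z k) & starts lam (processed Z k) = c].

Lemma solves_stale lam Z i c : Z < N -> ~~ fresh n g R Z i ->
  solves lam Z i c -> solves lam Z i.+1 c.
Proof. by move=> Z_lt; rewrite fresh_leader // /solves => /processed_stale->. Qed.

Lemma solves_fresh lam lam' Z i Z' c1 c2 : Z < N -> fresh n g R Z i ->
  link n m g R Z i Z' -> solves lam Z i c1 -> solves lam' Z' n c2 ->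
  exists lam'', solves lam'' Z i.+1 (c1 + c2 + is_start n (bag_code n Z' 0)).
Proof.
move=> Z_lt; rewrite fresh_leader // => lead_i linked.
move=> [ext_Z valid_Z <-] [ext_Z' valid_Z' <-]; have [u S] := link_split Z_lt linked.
exists (glue Z i lam lam'); split; first exact: glue_extends.
  exact: (glue_valid lead_i linked S).
exact: (glue_starts _ lead_i S).
Qed.

Lemma solves_base Z c : table_base n m Z c -> exists lam, solves lam Z 0 c.
Proof.
case/andP=> /eqP-> /consistent_extends[lam ext_Z]; exists lam.
by rewrite /solves processed0 /starts big_set0; split=> // v; rewrite inE.
Qed.

Lemma table_sound s (k : nat) Z c : k <= n -> Z < N -> table n m g R s k Z c ->
  exists lam, solves lam Z k c.
Proof.
elim: s k Z c => [|s IHs] k Z c + Z_lt; elim: k c => [|k IHk] c k_le;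
  rewrite ?table0 ?tableS; try exact: solves_base.
all: have {}IHk c' := IHk c' (ltnW k_le); rewrite /table_step; case: ifPn => fresh_k //.
1,3: by move=> /IHk[lam]; exists lam; apply: (@solves_stale _ _ (Ordinal k_le)).
case/andP=> _ /existsP[c1 /andP[/IHk[lam sol_Z]]].
case/existsP=> c2 /existsP[Z' /and3P[/(IHs _ _ _ (leqnn n) (ltn_ord Z'))[lam' sol_Z']]].
by move=> /eqP<- linked; apply: (@solves_fresh lam lam' Z (Ordinal k_le)) linked _ _.
Qed.

(** * Completeness of the dynamic program *)

Lemma empty_bag_lt : empty_bag n m < N.
Proof. by rewrite /empty_bag prednK // bag_bound_gt0. Qed.

Lemma empty_bag_code j : j <= m -> bag_code n (empty_bag n m) j = empty_code n.
Proof. by move=> jm; rewrite /bag_code digit_max // code_base_gt0. Qed.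

Lemma empty_code_digit j : j < 4 -> digit n.+1 (empty_code n) j = n.
Proof. by move=> j_lt; rewrite digit_max. Qed.

Lemma empty_bag_vertex j : j <= m -> bag_vertex n (empty_bag n m) j = n.
Proof.
by move=> jm; rewrite /bag_vertex empty_bag_code // /code_vertex empty_code_digit.
Qed.

Lemma rest_empty_bag : rest (empty_bag n m) = setT.
Proof.
apply/setP => u; rewrite !inE; apply/in_bagP => -[j jm].
by rewrite empty_bag_vertex // => nu; have := ltn_ord u; rewrite -nu ltnn.
Qed.

Lemma processed_empty_bag : processed (empty_bag n m) n = setT.
Proof.
rewrite processed_all; apply/setP => u; rewrite in_setT; apply/attachedP; exists u.
  by rewrite mem_component rest_empty_bag inE.
by rewrite /near /near_head empty_bag_vertex // eqxx.
Qed.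

Record labelling lam : Prop := Labelling {
  labelling_lt : forall v, lam v < code_base n;
  labelling_valid : valid lam setT }.

Section Labelled.
Variable lam : V -> nat.
Hypothesis lamP : labelling lam.

Definition label (v : nat) : nat :=
  if (insub v : option V) is Some u then lam u else empty_code n.

Definition labelled Z : Prop :=
  forall j, j <= m -> bag_code n Z j = label (bag_vertex n Z j).

Lemma label_ord v : label v = lam v. Proof. by rewrite /label valK. Qed.

Lemma label_none : label n = empty_code n.
Proof. by rewrite /label insubF // ltnn. Qed.

Lemma label_lt (v : nat) : label v < code_base n.
Proof.
rewrite /label; case: insub => [u|]; first exact: labelling_lt.
by rewrite /empty_code prednK ?code_base_gt0.
Qed.

Lemma label_digits (v : nat) : v <= n -> [/\ code_vertex n (label v) = v,
  (code_pred n (label v) == v) || g (code_pred n (label v)) v &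
  (code_succ n (label v) == v) || g v (code_succ n (label v))].
Proof.
rewrite leq_eqVlt => /orP[/eqP->|v_lt].
  by rewrite label_none /code_vertex /code_pred /code_succ !empty_code_digit // eqxx.
rewrite -[v]/(val (Ordinal v_lt)) label_ord.
have [/andP[/eqP vertex_v]] := labelling_valid lamP (in_setT (Ordinal v_lt)).
rewrite /admissible /is_start vertex_v => /andP[pred_v succ_v] _; split=> //.
by case/orP: pred_v => /andP[->]; rewrite ?orbT.
Qed.

Lemma label_compatible (u z : nat) : u <= n -> z <= n ->
  mutually_compatible n (label u) (label z).
Proof.
suff half (v w : nat) : v <= n -> w <= n -> ~~ g v w -> compatible n (label v) (label w).
  move=> u_le z_le; case uz : (g u z); last first.
    by apply/andP; split; apply: half => //; rewrite ?uz // represents_sym uz.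
  have /andP[u_lt z_lt] := represents_lt gG uz.
  have [_] := labelling_valid lamP (in_setT (Ordinal u_lt)).
  rewrite -[u]/(val (Ordinal u_lt)) -[z]/(val (Ordinal z_lt)) !label_ord; apply.
  by rewrite -(representsE gG).
move=> v_le w_le vw; have [vertex_v pred_v succ_v] := label_digits v_le.
have [vertex_w _ _] := label_digits w_le.
rewrite /compatible /pred_compatible /succ_compatible vertex_v vertex_w.
apply/andP; split; apply/implyP => /andP[/eqP eq_w wv].
  by move: pred_v; rewrite eq_w (negPf wv) represents_sym (negPf vw).
by move: succ_v; rewrite eq_w (negPf wv) (negPf vw).
Qed.

Lemma labelled_bag (f : nat -> nat) : (forall j, j <= m -> f j <= n) ->
  exists Z, [/\ Z < N, labelled Z & forall j, j <= m -> bag_vertex n Z j = f j].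
Proof.
move=> f_le; pose s := mkseq (label \o f) m.+1.
have s_lt : all (ltn^~ (code_base n)) s.
  by apply/allP => _ /mapP[j _ ->]; apply: label_lt.
have codeE j : j <= m -> bag_code n (pack (code_base n) s) j = label (f j).
  by move=> jm; rewrite /bag_code digit_pack ?size_mkseq ?nth_mkseq.
have vertexE j : j <= m -> bag_vertex n (pack (code_base n) s) j = f j.
  by move=> jm; rewrite /bag_vertex codeE //; have [] := label_digits (f_le j jm).
exists (pack (code_base n) s); split=> // [|j jm]; last by rewrite vertexE ?codeE.
by have := pack_lt s_lt; rewrite size_mkseq.
Qed.

Lemma labelled_empty_bag : labelled (empty_bag n m).
Proof. by move=> j jm; rewrite empty_bag_code // empty_bag_vertex // label_none. Qed.

Lemma labelled_consistent Z : labelled Z -> consistent n m Z.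
Proof.
move=> lab_Z; apply/forallP => j; apply/forallP => j'; apply/implyP => /eqP vertexE.
by rewrite (lab_Z j) ?(lab_Z j') -1?ltnS // vertexE.
Qed.

Lemma labelled_link Z i Z' u : Z < N -> labelled Z -> labelled Z' ->
  split_at Z i Z' u -> link n m g R Z i Z'.
Proof.
move=> Z_lt lab_Z lab_Z' [head_u uC tail boundary_tail]; apply/and5P; split.
- by rewrite head_u reach_component.
- rewrite lab_Z' // head_u label_ord.
  by have [/andP[]] := labelling_valid lamP (in_setT u).
- by apply/forallP => j; rewrite !lab_Z' ?label_compatible ?bag_vertex_le.
- apply/forallP => j; apply/existsP.
  have /tail/in_bagP[j' j'm vertexE] : in_tail n m Z' (bag_vertex n Z' j.+1).
    by apply/in_tailP; exists j.
  by exists (inord j'); rewrite inordK // lab_Z' // lab_Z // vertexE.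
- apply/forallP => x; apply/implyP; rewrite reach_component // => xC.
  apply/forallP => z; apply/implyP; rewrite (representsE gG) => xz.
  rewrite reach_component //; case: (boolP (z \in _)) => //= zC.
  exact/boundary_tail/(mem_boundary xC xz zC).
Qed.

Lemma table_labelled0 s Z :
  labelled Z -> table n m g R s 0 Z (starts lam (processed Z 0)).
Proof.
by move=> lab_Z; rewrite table0 processed0 /starts big_set0; apply: labelled_consistent.
Qed.

Lemma table_stale s Z i : Z < N -> ~~ fresh n g R Z i ->
  table n m g R s i Z (starts lam (processed Z i)) ->
  table n m g R s i.+1 Z (starts lam (processed Z i.+1)).
Proof.
move=> Z_lt stale; rewrite tableS /table_step ifN //.
by rewrite (fresh_leader _ Z_lt) in stale; rewrite processed_stale.
Qed.

Lemma table_extend s Z i Z' u : Z < N -> Z' < N -> labelled Z -> labelled Z' ->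
  split_at Z i Z' u -> fresh n g R Z i ->
  table n m g R s.+1 i Z (starts lam (processed Z i)) ->
  table n m g R s n Z' (starts lam (processed Z' n)) ->
  table n m g R s.+1 i.+1 Z (starts lam (processed Z i.+1)).
Proof.
move=> Z_lt Z'_lt lab_Z lab_Z' S fresh_i table_Z table_Z'.
have starts_lt A : starts lam A < n.+1 by rewrite ltnS starts_le.
have lead_i : leader G (rest Z) (near Z) i by rewrite -(fresh_leader _ Z_lt).
rewrite (starts_leader lam lead_i S) tableS /table_step fresh_i; apply/andP; split=> //.
apply/existsP; exists (Ordinal (starts_lt (processed Z i))); rewrite table_Z.
apply/existsP; exists (Ordinal (starts_lt (processed Z' n))).
apply/existsP; exists (Ordinal Z'_lt).
rewrite table_Z' (labelled_link Z_lt lab_Z lab_Z' S).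
by rewrite (lab_Z' 0) // (split_head S) label_ord eqxx.
Qed.

Lemma eq_rest Y Z : (forall j, j <= m -> bag_vertex n Y j = bag_vertex n Z j) ->
  [/\ in_bag n m Y = in_bag n m Z, in_tail n m Y = in_tail n m Z,
      rest Y = rest Z & near Y = near Z].
Proof.
move=> YZ.
have bagE : in_bag n m Y = in_bag n m Z.
  by apply/funext => u; apply: eq_existsb => j; rewrite YZ // -ltnS.
split=> //; last by apply/funext => u; rewrite /near /near_head YZ.
  by apply/funext => u; apply: eq_existsb => j; rewrite YZ.
by rewrite /rest bagE.
Qed.

(* Only the vertices of the bags of a derivation matter: relabelling all of
   them by lam turns it into a derivation for lam. *)
Lemma table_transfer s (k : nat) Z c Y : k <= n -> Z < N -> Y < N ->
  table n m g R s k Z c -> labelled Y ->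
  (forall j, j <= m -> bag_vertex n Y j = bag_vertex n Z j) ->
  table n m g R s k Y (starts lam (processed Y k)).
Proof.
elim: s k Z c Y => [|s IHs] k Z c Y + Z_lt Y_lt + lab_Y YZ;
  elim: k c => [|k IHk] c k_le; try by move=> _; apply: table_labelled0.
all: have {}IHk c' := IHk c' (ltnW k_le); have [bagE tailE restE nearE] := eq_rest YZ.
all: have freshE : fresh n g R Y (Ordinal k_le) = fresh n g R Z (Ordinal k_le)
  by rewrite (fresh_leader _ Y_lt) (fresh_leader _ Z_lt) restE nearE.
all: rewrite tableS {1}/table_step -freshE; case: ifPn => fresh_k //.
1,3: by move/IHk; apply: (@table_stale _ _ (Ordinal k_le)).
case/andP=> _ /existsP[c1 /andP[/IHk table_Y]].
case/existsP=> c2 /existsP[Z' /and3P[table_Z' _ linked]].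
have [u S] := link_split (i := Ordinal k_le) Z_lt linked.
have [Y' [Y'_lt lab_Y' YZ']] := labelled_bag (fun j _ => bag_vertex_le Z' j).
have [bagE' tailE' restE' nearE'] := eq_rest YZ'.
have table_Y' := IHs n _ _ _ (leqnn n) (ltn_ord Z') Y'_lt table_Z' lab_Y' YZ'.
have SY : split_at Y (Ordinal k_le) Y' u.
  by case: S => head_u uC tail boundary_tail; split; rewrite ?YZ' ?restE ?tailE' ?bagE.
exact: table_extend Y_lt Y'_lt lab_Y lab_Y' SY fresh_k table_Y table_Y'.
Qed.

Lemma next_bag Z i u : #|boundary G (component Z i)| <= m -> u \in component Z i ->
  exists Z', [/\ Z' < N, labelled Z' & split_at Z i Z' u].
Proof.
set bd := boundary G (component Z i) => bd_le uC.
pose f j := if j is j'.+1 then nth (bag_vertex n Z 0) (map val (enum bd)) j' else val u.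
have f_in_bag j : in_bag n m Z (f j.+1).
  rewrite /f; case: (ltnP j #|bd|) => j_lt; last first.
    by rewrite nth_default ?size_map -?cardE // mem_bag.
  rewrite (nth_map u) -?cardE //; set z := nth u _ _.
  have /component_boundary : z \in bd by rewrite -mem_enum mem_nth // -cardE.
  by rewrite inE negbK.
have [|Z' [Z'_lt lab_Z' Z'E]] := @labelled_bag f.
  case=> [|j] _; first exact/ltnW/ltn_ord.
  by have /in_bagP[j' _ <-] := f_in_bag j; apply: bag_vertex_le.
exists Z'; split=> //; split=> // [|v /in_tailP[j jm <-]|z z_bd]; rewrite ?Z'E //.
have idx_lt : index z (enum bd) < #|bd| by rewrite cardE index_mem mem_enum.
apply/in_tailP; exists (index z (enum bd)); first exact: leq_trans idx_lt bd_le.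
rewrite Z'E ?(leq_trans idx_lt) // /f (nth_map u) -?cardE // nth_index //.
by rewrite mem_enum.
Qed.

Lemma next_component_smaller Z i Z' u x : split_at Z i Z' u ->
  x \in attached G (rest Z') (near Z') -> #|component Z' x| < #|component Z i|.
Proof.
move=> S; rewrite -processed_all => xP.
rewrite (component_processed S) cardsU1 (split_head_notin _ S) ltnS.
by apply: subset_leq_card; move: xP; rewrite processed_all; apply: component_sub_attached.
Qed.

Lemma next_component_dominated key Z i Z' u x : split_at Z i Z' u ->
  {in component Z i, forall y, key y <= key u} -> dominated G key (component Z i) ->
  x \in attached G (rest Z') (near Z') -> dominated G key (component Z' x).
Proof.
move=> S u_max C_dom xH z y z_bd y_in.
have /subsetP sub : component Z' x \subset component Z i.
  rewrite (component_processed S) processed_all.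
  exact: subset_trans (component_sub_attached xH) (subsetUr _ _).
case: (eqVneq z u) => [->|zu]; first exact/u_max/sub.
apply: C_dom; last exact: sub.
have /boundaryP[_ [d dC dz]] := z_bd; apply: (mem_boundary (sub d dC) dz).
apply/negP => zC; have := component_boundary z_bd; rewrite inE negbK.
rewrite in_bagE (split_head S) val_eqE eq_sym (negPf zu) => /(split_tail S).
by have := subsetP (component_sub _ _ _) z zC; rewrite inE => /negPf->.
Qed.

Lemma table_complete key s Z : elimination_key G m key -> Z < N -> labelled Z ->
  {in attached G (rest Z) (near Z), forall x,
     #|component Z x| <= s /\ dominated G key (component Z x)} ->
  forall k, k <= n -> table n m g R s k Z (starts lam (processed Z k)).
Proof.
move=> key_ok; elim: s Z => [|s IHs] Z Z_lt lab_Z inv; elim=> [|k IHk] k_lt;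
  try exact: table_labelled0.
all: have {}IHk := IHk (ltnW k_lt); pose i : V := Ordinal k_lt.
all: case: (boolP (fresh n g R Z i)) => [fresh_i|stale];
  last exact: (@table_stale _ _ i).
all: have iH : i \in attached G (rest Z) (near Z)
  by rewrite (fresh_leader _ Z_lt) in fresh_i; case/andP: fresh_i.
all: have [C_le C_dom] := inv i iH; have iC : i \in component Z i
  by rewrite mem_component (subsetP (attached_sub _ _ _) _ iH).
  by move: C_le; rewrite leqn0 cards_eq0 => /eqP C0; rewrite C0 inE in iC.
have bd_le : #|boundary G (component Z i)| <= m.
  by apply: key_ok C_dom; [apply/set0Pn; exists i|exact: component_connected].
have [u uC u_max] : exists2 u, u \in component Z i &
    {in component Z i, forall y, key y <= key u}.
  by case: (arg_maxnP key iC) => u; exists u.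
have [Z' [Z'_lt lab_Z' S]] := next_bag bd_le uC.
apply: (table_extend Z_lt Z'_lt lab_Z lab_Z' S fresh_i IHk).
apply: (IHs Z' Z'_lt lab_Z' _ n (leqnn n)) => x xH; split.
  by rewrite -ltnS (leq_trans _ C_le) // (next_component_smaller S).
exact: next_component_dominated S u_max C_dom xH.
Qed.

End Labelled.

Lemma table_complete_empty_bag key lam : elimination_key G m key -> labelling lam ->
  table n m g R n n (empty_bag n m) (starts lam setT).
Proof.
move=> key_ok lamP; rewrite -processed_empty_bag.
apply: (table_complete lamP key_ok) => //; first exact: empty_bag_lt.
  exact: labelled_empty_bag.
move=> x _; split; first by rewrite -[leqRHS]card_ord max_card.
by move=> z y /component_boundary; rewrite rest_empty_bag in_setT.
Qed.

Lemma table_relabel lam c : table n m g R n n (empty_bag n m) c ->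
  labelling lam -> table n m g R n n (empty_bag n m) (starts lam setT).
Proof.
move=> table_c lamP; rewrite -processed_empty_bag.
apply: (table_transfer lamP (leqnn n) empty_bag_lt empty_bag_lt table_c) => //.
exact: labelled_empty_bag.
Qed.

Lemma table_valid c : table n m g R n n (empty_bag n m) c ->
  exists2 lam, valid lam setT & starts lam setT = c.
Proof.
case/(table_sound (leqnn n) empty_bag_lt) => lam [_].
by rewrite processed_empty_bag => valid_lam starts_lam; exists lam.
Qed.

(** * Solutions of the labelling problem are isometric path partitions *)

Lemma reach_empty_bag s u v : reach n m g s u v (empty_bag n m) <-> walk G s u v.
Proof.
have within_G : within G (rest (empty_bag n m)) =2 G.
  by move=> a b; rewrite /within /= rest_empty_bag !in_setT.
split=> [/reach_walk[_ /(eq_walk _ _ _ within_G)]//|/(eq_walk _ _ _ within_G) walk_v].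
by apply/reach_walk; rewrite {1}rest_empty_bag in_setT.
Qed.

Lemma closerP (x p v : V) : closer n m R x p v <->
  exists s, [/\ s < #|V|, walk G s x p & ~ walk G s x v].
Proof.
have reachE (s : nat) (y : V) : s < n ->
    R s x y (empty_bag n m) = reach n m g s x y (empty_bag n m).
  by move=> s_lt; rewrite ranged_reachE ?empty_bag_lt // ltnW.
rewrite card_ord; split=> [/existsP[s]|[s [s_lt walk_p no_walk]]].
  rewrite !reachE // => /andP[/reach_empty_bag walk_p no_walk].
  by exists s; split=> // /reach_empty_bag; apply/negP.
apply/existsP; exists (Ordinal s_lt); rewrite !reachE //; apply/andP.
by split; [apply/reach_empty_bag|apply/negP => /reach_empty_bag].
Qed.

Definition encodes lam (start prv nxt : V -> V) : Prop := forall v,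
  [/\ code_vertex n (lam v) = v, code_start n (lam v) = start v,
      code_pred n (lam v) = prv v & code_succ n (lam v) = nxt v].

Section Encoded.
Variables (lam : V -> nat) (start prv nxt : V -> V).
Hypothesis lamE : encodes lam start prv nxt.

Lemma vertex_ok_encoded v : vertex_ok v (lam v) =
  ((prv v == v) && (start v == v) ||
   G (prv v) v && closer n m R (start v) (prv v) v) && ((nxt v == v) || G v (nxt v)).
Proof.
rewrite /vertex_ok /admissible /is_start.
by have [-> -> -> ->] := lamE v; rewrite eqxx !(representsE gG) !val_eqE.
Qed.

Lemma compatible_encoded u z : compatible n (lam u) (lam z) =
  ((prv u == z) && (z != u) ==> (start z == start u) && (nxt z == u)) &&
  ((nxt u == z) && (z != u) ==> (start z == start u) && (prv z == u)).
Proof.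
rewrite /compatible /pred_compatible /succ_compatible.
by have [-> -> -> ->] := lamE u; have [-> -> -> ->] := lamE z; rewrite !val_eqE.
Qed.

Lemma valid_path_labels : valid lam setT <-> path_labels G start prv nxt.
Proof.
split=> [valid_lam|labels].
  have ok v : vertex_ok v (lam v) by have [] := valid_lam v (in_setT v).
  have compat u z : G u z -> compatible n (lam u) (lam z).
    by have [_ /(_ z) h] := valid_lam u (in_setT u) => /h/andP[].
  split=> v; have := ok v; rewrite vertex_ok_encoded => /andP[prv_ok nxt_ok].
  - move=> prv_v; move: prv_ok; rewrite prv_v adj_irrefl orbF.
    by case/andP=> _ /eqP.
  - by move=> /negPf moved; move: prv_ok; rewrite moved => /andP[].
  - by move=> /negPf moved; move: prv_ok; rewrite moved => /andP[_ /closerP].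
  - by move=> /negPf moved; rewrite moved in nxt_ok.
  - move=> moved; move: prv_ok; rewrite (negPf moved) => /andP[adj_prv _].
    have := compat v (prv v); rewrite adj_sym => /(_ adj_prv).
    by rewrite compatible_encoded eqxx moved /= => /andP[/andP[/eqP-> /eqP->]].
  - move=> moved; rewrite (negPf moved) /= in nxt_ok.
    have := compat v (nxt v) nxt_ok; rewrite compatible_encoded eqxx moved /=.
    by case/andP=> _ /andP[/eqP-> /eqP->].
have [start_ok prv_adj closer_ok nxt_adj prvK nxtK] := labels.
have compat u z : compatible n (lam u) (lam z).
  rewrite compatible_encoded; apply/andP; split; apply/implyP => /andP[/eqP <- moved].
    by have [-> ->] := prvK u moved; rewrite !eqxx.
  by have [-> ->] := nxtK u moved; rewrite !eqxx.
move=> v _; split=> [|z _]; last by rewrite /mutually_compatible !compat.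
rewrite vertex_ok_encoded; apply/andP; split; last first.
  by case: eqVneq => // /nxt_adj.
case: eqVneq => [/start_ok->|moved]; first by rewrite eqxx.
by rewrite prv_adj //=; apply/closerP/closer_ok.
Qed.

Lemma starts_encoded : starts lam setT = #|[set v | prv v == v]|.
Proof.
rewrite /starts -sum1_card [LHS]big_mkcond [RHS]big_mkcond; apply: eq_bigr => v _.
by rewrite !inE /is_start; have [-> _ -> _] := lamE v; rewrite val_eqE; case: eqP.
Qed.

End Encoded.

Lemma valid_encodes lam :
  valid lam setT -> exists start prv nxt, encodes lam start prv nxt.
Proof.
move=> valid_lam; pose vertex_of v (d : nat) : V := insubd v d.
exists (fun v => vertex_of v (code_start n (lam v))),
  (fun v => vertex_of v (code_pred n (lam v))),
  (fun v => vertex_of v (code_succ n (lam v))) => v.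
have [/andP[/eqP vertex_v /andP[pred_ok succ_ok]] _] := valid_lam v (in_setT v).
rewrite vertex_v in pred_ok succ_ok; rewrite !val_insubd vertex_v.
rewrite /is_start vertex_v in pred_ok.
have [-> ->] : code_start n (lam v) < n /\ code_pred n (lam v) < n.
  case/orP: pred_ok => /andP[]; first by move=> /eqP-> /eqP->; rewrite ltn_ord.
  move=> /(represents_lt gG)/andP[-> _] /existsP[s /andP[/andP[_]]].
  by case/reach_in_range=> ->.
by case/orP: succ_ok => [/eqP->|/(represents_lt gG)/andP[_ ->]]; rewrite ?ltn_ord.
Qed.

Lemma partition_of_valid lam :
  valid lam setT -> isometric_path_partition G (starts lam setT).
Proof.
move=> valid_lam; have [start [prv [nxt lamE]]] := valid_encodes valid_lam.
rewrite (starts_encoded lamE); apply: (partition_of_labels (start := start) (nxt := nxt)).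
exact/(valid_path_labels lamE).
Qed.

Lemma labelling_of_partition k : isometric_path_partition G k ->
  exists2 lam, labelling lam & starts lam setT = k.
Proof.
move=> /labels_of_partition[start [prv [nxt [labels <-]]]].
pose lam v := vertex_code n v (start v) (prv v) (nxt v).
have digits_lt v : all (ltn^~ n.+1) [:: val v; val (start v); val (prv v); val (nxt v)].
  by rewrite /= !ltnS !(ltnW (ltn_ord _)).
have lamE : encodes lam start prv nxt.
  by move=> v; split; apply: (digit_pack (digits_lt v)).
exists lam; last exact: starts_encoded lamE.
by split=> [v|]; [exact: pack_lt (digits_lt v) | exact/(valid_path_labels lamE)].
Qed.

End Correctness.

(** * The search for the width *)

Record instance := Instance {
  ins_inp : seq nat;
  ins_width : nat;
  ins_heap : nat -> nat;
  ins_vertices : 0 < nth 0 ins_inp 0;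
  ins_edges : nth 0 ins_inp 2 <= cell_count (nth 0 ins_inp 0) ins_width }.

Definition ins_cells (x : instance) : nat :=
  cell_count (nth 0 (ins_inp x) 0) (ins_width x).

Definition instance_ctx : ctx := @Ctx instance ins_inp ins_heap ins_cells [:: ins_width].

Canonical sized_instance : sized_ctx :=
  @SizedCtx instance_ctx ins_width (@computable_var instance_ctx 0 isT)
    ins_vertices ins_edges (fun=> leqnn _).

Definition filling_ctx : ctx := @fill_ctx instance_ctx ins_cells.

Canonical sized_filling : sized_ctx :=
  @SizedCtx filling_ctx (fun y => ins_width (tag y)) (@computable_var filling_ctx 1 isT)
    (fun y => ins_vertices (tag y)) (fun y => ins_edges (tag y)) (fun=> leqnn _).

Lemma small_ins_cells : @small instance_ctx ins_cells.
Proof.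
split; last by move=> x; apply: leqnn.
by apply: (@computable_exp instance_ctx); [exact: small_bag_bound|exact: small_const].
Qed.

Definition table_in_heap (inp : seq nat) (w : nat) (m : memory) : Prop :=
  forall a, a < cell_count (nth 0 inp 0) w ->
    m a.*2.+1 = cell (nth 0 inp 0) w (input_adj inp) a.

Definition final_table (inp : seq nat) (w c : nat) : bool :=
  let n := nth 0 inp 0 in
  table n w (input_adj inp) (ranged_reach n w (input_adj inp)) n n (empty_bag n w) c.

Definition final_addr (n w c : nat) : nat := addr n w 1 n n c (empty_bag n w).

Lemma read_final_cell inp w c m : 0 < nth 0 inp 0 -> c <= nth 0 inp 0 ->
  table_in_heap inp w m ->
  m (final_addr (nth 0 inp 0) w c).*2.+1 = final_table inp w c.
Proof.
set n := nth 0 inp 0 => n_gt0 c_le filled.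
have ran : in_range n w n n c (empty_bag n w).
  by rewrite /in_range empty_bag_lt !ltn_bag_bound.
have one_lt : 1 < bag_bound n w by apply: ltn_bag_bound.
by rewrite filled ?addr_lt // cell_addr.
Qed.

Lemma computable_final_cell (c : instance_ctx -> nat) : computable c ->
  @computable instance_ctx
    (fun x => cheap x (final_addr (vertex_count x) (ctx_width x) (c x))).
Proof. by rewrite /final_addr => comp_c; repeat program_step. Qed.

Lemma fill_table_program :
  exists (c : cmd) (K : nat), forall (x : instance_ctx) m, stores [:: 1] x m ->
  runs (cinp x) (cbound x) K c m (fun m' =>
    m' 1.*2 = m 1.*2 /\ table_in_heap (ins_inp x) (ins_width x) m').
Proof.
pose step (x : instance) h a := cell_step (nth 0 (ins_inp x) 0) (ins_width x)
  (input_adj (ins_inp x)) h a : nat.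
pose cells (x : instance) a := cell (nth 0 (ins_inp x) 0) (ins_width x)
  (input_adj (ins_inp x)) a : nat.
have comp_step : @computable filling_ctx
    (fun y => step (tag y) (fill_heap y) (fill_addr y)).
  exact/(computable_cell_step (X := sized_filling))/small_fill_addr/small_ins_cells.
have stepE x h a : a < ins_cells x -> (forall a0, a0 < a -> h a0 = cells x a0) ->
    step x h a = cells x a.
  by move=> a_lt below; rewrite /step cell_step_correct.
have fill := fill_program small_ins_cells comp_step stepE.
have [//|c [K run_c]] := fill [:: 1] 2; exists c, K => x m sto.
apply: runsW (run_c x m sto) => // m' [regs cells_m'].
by split=> //; apply: regs.
Qed.

(* Register 1 holds the width, register 2 the outcome of the test. *)
Lemma test_width_program :
  exists (c : cmd) (K : nat), forall inp w m, 0 < nth 0 inp 0 ->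
  nth 0 inp 2 <= cell_count (nth 0 inp 0) w.+1 -> m 1.*2 = w ->
  runs inp (cell_count (nth 0 inp 0) w.+1) K c m (fun m' =>
    [/\ m' 1.*2 = w.+1, m' 2.*2 = final_table inp w.+1 (nth 0 inp 0)
      & table_in_heap inp w.+1 m']).
Proof.
have [cF [KF run_F]] := fill_table_program.
have [comp_final] := computable_final_cell (computable_vertex_count instance_ctx).
have [//|cD [KD run_D]] := comp_final [:: 1] 2.
exists (CSeq (incr_reg 1) (CSeq cF cD)); eexists=> inp w m n_gt0 edges width_m.
apply: (runs_seq (P := fun m' => m' 1.*2 = w.+1)) => [|m1 width1].
  by apply: runs_incr_reg; rewrite update_same width_m.
pose x1 : instance_ctx := @Instance inp w.+1 (fun a => m1 a.*2.+1) n_gt0 edges.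
apply: runs_seq (run_F x1 m1 _) _ => [|m2 [width2 filled2]].
  by split=> // -[|j].
pose x2 : instance_ctx := @Instance inp w.+1 (fun a => m2 a.*2.+1) n_gt0 edges.
apply: runsW (run_D x2 m2 _) => // [m3 [test3 [regs3 heap3]]|].
  split; [by rewrite regs3 // width2 | | by move=> a a_lt; rewrite heap3 filled2].
  by rewrite test3; apply: read_final_cell.
by split=> // -[|j] // _; rewrite /= width2.
Qed.

Lemma answer_program :
  exists (c : cmd) (K : nat), forall inp w m, 0 < nth 0 inp 0 ->
  nth 0 inp 2 <= cell_count (nth 0 inp 0) w -> m 1.*2 = w -> table_in_heap inp w m ->
  runs inp (cell_count (nth 0 inp 0) w) K c m (fun m' =>
    m' 0 = (nth 0 inp 1 <= nth 0 inp 0) && final_table inp w (nth 0 inp 1)).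
Proof.
pose k (x : instance_ctx) := nth 0 (cinp x) 1.
have comp_k : computable k by exact/computable_input/computable_const.
pose answer (x : instance_ctx) := (k x <= vertex_count x) &&
  (cheap x (final_addr (vertex_count x) (ctx_width x) (k x)) != 0).
have [comp_answer] : @computable instance_ctx (fun x => answer x).
  apply: computable_andb; first exact: computable_leq (computable_vertex_count _).
  exact/computable_negb/(computable_eq (computable_final_cell comp_k))/computable_const.
have [//|c [K run_c]] := comp_answer [:: 1] 2.
exists (CSeq c (set_reg 0 (reg 2))); eexists=> inp w m n_gt0 edges width_m filled.
pose x : instance_ctx := @Instance inp w (fun a => m a.*2.+1) n_gt0 edges.
apply: runs_seq (run_c x m _) _ => [|m1 [answer1 _]]; first by split=> // -[|j].
apply: runs_set_reg; rewrite -[0 in LHS]/(0.*2) update_same [eval _ _ _]answer1 /answer.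
congr nat_of_bool; apply: andb_id2l => k_le.
by rewrite [cheap x _](read_final_cell n_gt0 k_le filled) eqb0 negbK.
Qed.

Lemma search_program :
  exists (c : cmd) (K : nat), forall inp W, 0 < nth 0 inp 0 ->
  nth 0 inp 2 <= cell_count (nth 0 inp 0) 1 ->
  (forall w, w <= W -> final_table inp w.+1 (nth 0 inp 0) = (w == W)) ->
  runs inp (cell_count (nth 0 inp 0) W.+1) K c memory0 (fun m' =>
    m' 0 = (nth 0 inp 1 <= nth 0 inp 0) && final_table inp W.+1 (nth 0 inp 1)).
Proof.
have [cT [KT run_T]] := test_width_program; have [cA [KA run_A]] := answer_program.
exists (CSeq (CWhile (ESub (EConst 1) (reg 2)) cT) cA); eexists=> inp W n_gt0 edges testE.
set n := nth 0 inp 0 in n_gt0 edges testE *.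
have leq_cells w w' : w <= w' -> cell_count n w <= cell_count n w'.
  by move=> ww'; rewrite leq_exp2r // leq_pexp2l // code_base_gt0.
have edges_le w : nth 0 inp 2 <= cell_count n w.+1.
  by apply: leq_trans edges (leq_cells _ _ _).
pose inv w m := [/\ m 1.*2 = w, m 2.*2 = (w == W.+1) & 0 < w -> table_in_heap inp w m].
apply: (runs_seq (P := inv W.+1)); last first.
  by move=> m [width_m _ filled]; apply: run_A => //; apply: filled.
have W_lt : W.+1 <= cell_count n W.+1.
  pose x := @Instance inp W.+1 (fun=> 0) n_gt0 (edges_le W).
  exact: (small_bounded (small_ctx_width sized_instance) x).
apply: (runs_while W_lt) => [w m w_le [width_m flag_m _]|m [_ flag_m _]|].
- split; first by rewrite /= flag_m (ltn_eqF w_le).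
  apply: runsW (run_T inp w m n_gt0 (edges_le w) width_m).
  + exact: leq_cells.
  + exact: leqnn.
  by move=> m' [width' test' filled']; split; rewrite // test' testE.
- by rewrite /= flag_m eqxx.
by [].
Qed.

(** * Running time and correctness *)

Section Input.
Variables (n : nat) (G : sgraph 'I_n) (k : nat) (l : seq ('I_n * 'I_n)).
Hypothesis Gl : edge_list G l.

Lemma nth_flatten_pairs d e : e < size l ->
  let s := flatten [seq [:: val uv.1; val uv.2] | uv <- l] in
  nth 0 s (e + e) = (nth d l e).1 /\ nth 0 s (e + e).+1 = (nth d l e).2.
Proof. by elim: l e => [|uv s IH] // [|e] //= e_lt; rewrite addnS; apply: IH. Qed.

Lemma input_adjP u v : reflect (exists2 e, e \in l &
    (val e.1, val e.2) = (u, v) \/ (val e.1, val e.2) = (v, u))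
  (input_adj (encode l k) u v).
Proof.
apply: (iffP existsP) => [[[e e_lt] /=]|[[a b] ab_l uv]].
  have d : 'I_n * 'I_n by case: l e_lt => [//|x s _].
  have [-> ->] := nth_flatten_pairs d e_lt => uv.
  exists (nth d l e); first exact: mem_nth.
  by case/orP: uv => /andP[/eqP<- /eqP<-]; [left|right].
have e_lt : index (a, b) l < size l by rewrite index_mem.
exists (Ordinal e_lt) => /=; have [-> ->] := nth_flatten_pairs (a, b) e_lt.
by rewrite nth_index //=; case: uv => -[-> ->]; rewrite !eqxx ?orbT.
Qed.

Lemma mem_edge_list u v : ((u, v) \in l) || ((v, u) \in l) = G u v.
Proof.
have := Gl u v; rewrite -!has_pred1 !has_count.
by case: (G u v) => /=; case: (count_mem (u, v) l) (count_mem (v, u) l) => [|x] [|y].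
Qed.

Lemma represents_input_adj : represents (input_adj (encode l k)) G.
Proof.
split=> [u v /input_adjP[[a b] _ []] [<- <-]|u v]; rewrite ?ltn_ord //.
rewrite -mem_edge_list; apply/input_adjP/orP => [[[a b] ab_l]|[uv_l|vu_l]].
- by case=> -[/val_inj ea /val_inj eb]; rewrite ea eb in ab_l; [left|right].
- by exists (u, v); first done; left.
- by exists (v, u); first done; right.
Qed.

Lemma size_edge_list : size l <= n * n.
Proof.
have uniq_l : uniq l.
  apply: count_mem_uniq => -[u v]; have := Gl u v; rewrite -has_pred1 has_count.
  by case: (G u v); case: (count_mem (u, v) l) => [|[|x]] //=; case: (count_mem _ _).
by have := max_card (mem l); rewrite (card_uniqP uniq_l) card_prod card_ord.
Qed.

End Input.

Section Treewidth.
Variables (V : finType) (G : sgraph V).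

Lemma has_treewidth : has_width G (treewidth G).
Proof. by rewrite /treewidth; case: ex_minnP => w /asboolP. Qed.

Lemma treewidth_le w : has_width G w -> treewidth G <= w.
Proof. by rewrite /treewidth; case: ex_minnP => w' _ least /asboolP/least. Qed.

Lemma leq_bag_width (T : finType) (bag : T -> {set V}) t : #|bag t| <= (width bag).+1.
Proof.
by apply: (leq_trans _ (leqSpred _)); apply: (@leq_bigmax _ (fun t => #|bag t|) t).
Qed.

Lemma treewidth_le_card : treewidth G <= #|V|.-1.
Proof.
apply: treewidth_le; pose no_edge := [rel _ _ : unit | false].
have [sym irr] : symmetric no_edge /\ irreflexive no_edge by [].
exists unit, (SGraph sym irr), (fun=> setT); split; last first.
  by rewrite /width big_const card_unit /= maxn0 cardsT.
split=> [|v|u v _|v [] [] _ _]; last exact: connect0.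
- by split=> [|[] []|[|x [|y c]]]; rewrite ?card_unit ?connect0.
- by exists tt; rewrite inE.
by exists tt; rewrite !inE.
Qed.

Lemma treewidth_gt0 u v : G u v -> 0 < treewidth G.
Proof.
move=> uv; have [T [F [bag [[_ _ bag_edge _] <-]]]] := has_treewidth.
have [t /andP[ut vt]] := bag_edge _ _ uv; rewrite -ltnS.
apply: leq_trans (leq_bag_width bag t); apply/card_gt1P; exists u, v; split=> //.
by apply: contraTneq uv => ->; rewrite adj_irrefl.
Qed.

Lemma treewidth_elimination_key : exists key, elimination_key G (treewidth G) key.
Proof.
have [T [F [bag [dec <-]]]] := has_treewidth.
exact: elimination_key_of_decomposition dec (leq_bag_width bag).
Qed.

End Treewidth.

Section Threshold.
Variables (n : nat) (G : sgraph 'I_n) (k : nat) (l : seq ('I_n * 'I_n)).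
Hypothesis Gl : edge_list G l.
Local Notation inp := (encode l k).

Lemma final_table_correct w c : final_table inp w n ->
  final_table inp w c <-> isometric_path_partition G c.
Proof.
have gG := represents_input_adj k Gl => table_n; split.
  by move/(table_valid gG) => [lam valid_lam <-]; apply: partition_of_valid valid_lam.
move/(labelling_of_partition w gG) => [lam lamP <-].
exact: (table_relabel gG table_n lamP).
Qed.

Lemma final_table_treewidth : final_table inp (treewidth G) n.
Proof.
have gG := represents_input_adj k Gl; have [key key_ok] := treewidth_elimination_key G.
have [lam lamP starts_lam] :=
  labelling_of_partition (treewidth G) gG (trivial_partition G).
have := table_complete_empty_bag gG key_ok lamP.
by rewrite starts_lam card_ord.
Qed.

Lemma least_width : 0 < treewidth G -> exists W, [/\ W < treewidth G,
  final_table inp W.+1 n & forall w, w <= W -> final_table inp w.+1 n = (w == W)].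
Proof.
move=> tw_gt0; have : exists w, final_table inp w.+1 n.
  by exists (treewidth G).-1; rewrite prednK //; apply: final_table_treewidth.
case/ex_minnP=> W table_W least; exists W; split=> // [|w].
  by rewrite -(prednK tw_gt0) ltnS least // prednK //; apply: final_table_treewidth.
rewrite leq_eqVlt => /orP[/eqP->|wW]; first by rewrite table_W eqxx.
by rewrite (ltn_eqF wW); apply: contraTF wW => /least; rewrite -leqNgt.
Qed.

End Threshold.

Lemma edgeless_program : exists (c : cmd) (K : nat), forall inp m,
  runs inp 0 K c m (fun m' => m' 0 = (nth 0 inp 1 == nth 0 inp 0)).
Proof.
pose n := EInput (EConst 0); pose k := EInput (EConst 1).
exists (set_reg 0 (ESub (EConst 1) (EAdd (ESub n k) (ESub k n)))); eexists=> inp m.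
by apply: runs_set_reg; rewrite -[0 in LHS]/(0.*2) update_same /=; case: ltngtP; lia.
Qed.

Lemma cell_count_lt_exp n w : 1 < n -> 0 < w -> cell_count n w < n ^ (81 * w).
Proof.
move=> n_gt1 w_gt0; have n_gt0 := ltnW n_gt1.
have square : n.+1 <= n ^ 2.
  apply: (@leq_trans (2 * n)); first by rewrite mul2n -addnn -addn1 leq_add2l.
  by rewrite -mulnn leq_mul2r n_gt1 orbT.
have cells : cell_count n w <= n ^ (80 * w).
  rewrite /cell_count /bag_bound /code_base -!expnM.
  apply: (@leq_trans ((n ^ 2) ^ (4 * (w.+1 * 5)))); first by rewrite leq_exp2r.
  by rewrite -expnM leq_pexp2l //; lia.
apply: leq_ltn_trans cells _; rewrite ltn_exp2l //; lia.
Qed.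

Lemma size_edge_list_le_cells n (G : sgraph 'I_n) (l : seq ('I_n * 'I_n)) :
  edge_list G l -> size l <= cell_count n 1.
Proof.
move=> Gl; apply: leq_trans (size_edge_list Gl) _.
rewrite /cell_count /bag_bound /code_base -!expnM mulnn.
by apply: (@leq_trans (n.+1 ^ 2)); [rewrite leq_exp2r | rewrite leq_pexp2l].
Qed.

Lemma decision_program : exists (c : cmd) (K : nat),
  forall (n : nat) (G : sgraph 'I_n) (k : nat) (l : seq ('I_n * 'I_n)),
  edge_list G l -> exists2 B, B < n ^ (81 * treewidth G) &
    runs (encode l k) B K c memory0 (fun m => m 0 != 0 <-> isometric_path_partition G k).
Proof.
have [cS [KS run_S]] := search_program; have [cE [KE run_E]] := edgeless_program.
exists (CIf (EInput (EConst 2)) cS cE); eexists=> n G k l Gl.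
case: (posnP (size l)) => [l0|l_gt0].
  exists 0; last first.
    apply: runs_if => [|_]; first by rewrite /= l0.
    apply: runsW (run_E _ _) => // m ->; rewrite eqb0 negbK.
    rewrite edgeless_partition ?card_ord; first by split=> /eqP.
    by move=> u v; rewrite -(mem_edge_list Gl) (size0nil l0).
  case: n G l Gl l0 => [|n] G l _ _; last by rewrite expn_gt0.
  by have := treewidth_le_card G; rewrite card_ord leqn0 => /eqP->.
have [u [v uv]] : exists u v, G u v.
  case: l Gl l_gt0 => // -[u v] l' Gl _; exists u, v.
  by rewrite -(mem_edge_list Gl) mem_head.
have n_gt1 : 1 < n.
  rewrite -[n]card_ord; apply/card_gt1P; exists u, v; split=> //.
  by apply: contraTneq uv => ->; rewrite adj_irrefl.
have [W [W_lt table_W least]] := least_width k Gl (treewidth_gt0 uv).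
exists (cell_count n W.+1).
  apply: leq_trans (cell_count_lt_exp n_gt1 (ltn0Sn W)) _.
  by rewrite leq_pexp2l ?(ltnW n_gt1) // leq_mul2l.
apply: runs_if => [_|/= l0]; last by rewrite l0 in l_gt0.
have := run_S (encode l k) W (ltnW n_gt1) (size_edge_list_le_cells Gl) least.
have correct := final_table_correct Gl k table_W.
apply: runsW => // m ->; rewrite eqb0 negbK.
split=> [/andP[_ /correct]//|part]; apply/andP; split; last exact/correct.
by have := partition_card part; rewrite card_ord.
Qed.

Theorem theorem1 :
  exists (prog : cmd) (C : nat),
    forall (n : nat) (G : sgraph 'I_n) (k : nat) (l : seq ('I_n * 'I_n)),
      edge_list G l ->
      exists (t : nat) (m : memory),
        [/\ exec (encode l k) prog memory0 t m,
            m 0 != 0 <-> isometric_path_partition G k &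
            t <= C * n ^ (C * treewidth G)].
Proof.
have [c [K run_c]] := decision_program; exists c, (81 * K) => n G k l Gl.
have [B B_lt [t [m [E t_le correct]]]] := run_c n G k l Gl.
exists t, m; split=> //; apply: leq_trans t_le _; rewrite /poly_bound.
apply: leq_mul; first exact: leq_pmull.
by rewrite mulnAC expnM; case: K {run_c} => // K; rewrite leq_exp2r.
Qed.
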